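(* Let $W$ be a simply laced Weyl group. Let $v,w\in W$ be such that $v\leq w$ and $\ell(v,w)=2$. Then there exist positive roots $\alpha,\gamma,\alpha^\circ,\gamma^\circ$ such that $x_{w/v}=x_\alpha x_\gamma$ and $x_{w/v}^\circ=x_{\alpha^\circ}x_{\gamma^\circ}$ in $\mathscr B_W$. Each choice of such positive roots $\alpha,\gamma,\alpha^\circ,\gamma^\circ$ satisfies $\alpha\neq\gamma$ and $\alpha^\circ\neq\gamma^\circ$. Moreover, the sets $\{\alpha,\gamma\}$ and $\{\alpha^\circ,\gamma^\circ\}$ are uniquely determined by $v,w$.
   Context: Coxeter setup. $(W,S)$ is a Coxeter system with $W$ finite; $m(s,s')$ is the order of $ss'$. $\mathfrak h_{\mathbb R}$ is a real vector space with basis $\Delta$ (the simple roots), in bijection with $S$ via $\beta\mapsto s_\beta$, with symmetric bilinear form $B(\beta,\beta')=-\cos(\pi/m(s_\beta,s_{\beta'}))$. $W$ acts by $s_\beta(x)=x-2B(x,\beta)\beta$. $R=\{u(\beta):u\in W,\beta\in\Delta\}$ is the root system, and the positive roots $R^+$ are the roots that are nonnegative linear combinations of $\Delta$. For $\alpha=u(\beta)\in R$, $s_\alpha=us_\beta u^{-1}$. $\ell$ is the length function, $\ell(v,w)=\ell(w)-\ell(v)$, $\leq$ the (strong) Bruhat order. A simply laced Weyl group is the Weyl group of a reduced irreducible crystallographic root system whose Dynkin diagram has only simple edges (types $\mathsf A_n,\mathsf D_n,\mathsf E_6,\mathsf E_7,\mathsf E_8$); equivalently $(W,S)$ is irreducible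 and all $m(s,s')\leq3$, and the two root systems then agree (up to normalization of the scalar product). Nichols algebra $\mathscr B_W$. $V_W$ is the complex vector space spanned by symbols $x_\alpha$ ($\alpha\in R$) modulo $x_{-\alpha}=-x_\alpha$; $\{x_\alpha:\alpha\in R^+\}$ is a basis. $W$ acts by $ux_\alpha=x_{u(\alpha)}$, and $V_W$ is $W$-graded with $x_\alpha$ of degree $s_\alpha$. The braiding is $\Psi(x_\alpha\otimes y)=s_\alpha y\otimes x_\alpha$ on $V_W^{\otimes 2}$. For $\sigma$ in the symmetric group $\mathbb S_m$ with reduced expression $s_{i_1}\cdots s_{i_k}$, $\Psi_\sigma=\Psi_{i_1}\cdots\Psi_{i_k}$ on $V_W^{\otimes m}$, where $\Psi_i$ is $\Psi$ applied to factors $i,i+1$; the braided factorial is $[m]!=\sum_{\sigma\in\mathbb S_m}\Psi_\sigma$. $\mathscr B_W=T(V_W)/\bigoplus_m\ker[m]!$. $T(V_W)$, with multiplicatively extended $W$-action and $W$-grading, is a braided Hopf algebra: $\Delta$ is the algebra homomorphism to $T(V_W)\otimes T(V_W)$ with twisted multiplication $(a\otimes b)\cdot(c\otimes d)=a(gc)\otimes bd$ for $b$ of $W$-degree $g$, and $\Delta(x)=x\otimes1+1\otimes x$ for $x\in V_W$. This structure descends to $\mathscr B_W$. Elements. For $w\in W$ with reduced expression $s_{\beta_1}\cdots s_{\beta_k}$, $x_w=x_{\beta_1}\cdots x_{\beta_k}\in\mathscr B_W$ (well defined; the $x_w$, $w\in W$, are linearly independent). The elements $x_{w/v}\in\mathscr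 B_W$ for $v\leq w$ are uniquely determined by $\Delta(x_w)=\sum_{v\leq w}x_{w/v}\otimes x_v$; $x_{w/v}=0$ if $v\not\leq w$. $\rho:\mathscr B_W\to\mathscr B_W$ is the anti-algebra involution with $\rho(x_{\alpha_1}\cdots x_{\alpha_m})=x_{\alpha_m}\cdots x_{\alpha_1}$, and $x_{w/v}^\circ=\rho(x_{w^{-1}/v^{-1}})$. *)

(* Defs.v *)
From HB Require Import structures.
From mathcomp Require Import all_boot all_order all_fingroup all_algebra.
From mathcomp Require Import finmap.
From mathcomp.multinomials Require Import monalg.
From mathcomp.real_closed Require Import complex.
From mathcomp Require Import boolp classical_sets reals trigo.

Set Implicit Arguments.
Unset Strict Implicit.
Unset Printing Implicit Defensive.

Import Order.TTheory GRing.Theory Num.Theory.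

Local Open Scope ring_scope.

Section Words.
Local Open Scope group_scope.
Variables (gT : finGroupType) (I : choiceType) (s : I -> gT).
Implicit Types (g : gT) (e : seq I).

Definition word_prod e : gT := \prod_(i <- e) s i.

Definition reduced e : Prop :=
  forall e', word_prod e' = word_prod e -> (size e <= size e')%N.

(* Some reduced expression of [g]; the junk value [::] is only taken when [g]
   is not in the subgroup generated by the image of [s]. *)
Definition red_word g : seq I :=
  xget [::] [set e | word_prod e = g /\ reduced e]%classic.

Definition len g : nat := size (red_word g).

End Words.

Section Coxeter.
Local Open Scope group_scope.
Variables (gT : finGroupType) (n : nat) (s : 'I_n -> gT).

Definition cox_m (i j : 'I_n) : nat := #[s i * s j].

(* The pair (gT, {s_0, ..., s_(n-1)}) is a Coxeter system: gT is generated by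
   the s_i and has the presentation
   < s_i | (s_i s_j)^m(i,j) = 1 > with m(i,j) = cox_m i j (all orders are
   finite here), expressed by the universal property among all groups. *)
Definition coxeter_system : Prop :=
  [/\ injective s,
      forall i, #[s i] = 2%N,
      <<[set s i | i in 'I_n]>> = [set: gT] &
      forall (H : groupType) (f : 'I_n -> H),
        (forall i j, (f i * f j) ^+ cox_m i j = 1) ->
        exists F : gT -> H,
          (forall x y, F (x * y) = F x * F y) /\ (forall i, F (s i) = f i)].

Definition irreducible_system : Prop :=
  (0 < n)%N /\
  forall J : {set 'I_n},
    (exists i, i \in J) -> (exists j, j \notin J) ->
    exists i j, [/\ i \in J, j \notin J & s i * s j <> s j * s i].

Definition simply_laced_weyl_group : Prop :=
  [/\ coxeter_system, irreducible_system &
      forall i j, (cox_m i j <= 3)%N].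

Definition bruhat_step (v w : gT) : bool :=
  [exists u : gT, exists i : 'I_n, w == v * (u * s i * u^-1)]
  && (len s v < len s w)%N.

Definition bruhat (v w : gT) : bool := connect bruhat_step v w.

End Coxeter.

Section Roots.
Variables (R : realType) (gT : finGroupType) (n : nat) (s : 'I_n -> gT).
(* Vectors are written in coordinates with respect to the simple roots. *)
Implicit Types (x y : 'rV[R]_n).

Definition simple_root (i : 'I_n) : 'rV[R]_n := delta_mx 0 i.

Definition gram : 'M[R]_n :=
  \matrix_(i, j) - cos (pi / (cox_m s i j)%:R).

Definition bform x y : R := (x *m gram *m y^T) 0 0.

Definition simple_refl (i : 'I_n) x : 'rV[R]_n :=
  x - (2 * bform x (simple_root i)) *: simple_root i.

Definition geom_act (u : gT) x : 'rV[R]_n :=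
  foldr simple_refl x (red_word s u).

Definition is_root x : bool :=
  [exists u : gT, exists i : 'I_n, x == geom_act u (simple_root i)].

Definition is_posroot x : bool := is_root x && [forall i, 0 <= x 0 i].

Definition posroot : Type := {x : 'rV[R]_n | is_posroot x}.

HB.instance Definition _ := SubChoice.on posroot.

(* s_a = u s_b u^-1 for a = u(b); it does not depend on the choice of (u, b). *)
Definition root_refl x : gT :=
  if [pick p : gT * 'I_n | geom_act p.1 (simple_root p.2) == x] is Some p
  then (p.1 * s p.2 * p.1^-1)%g else 1%g.

End Roots.

Definition fword (K : Type) : Type := seq K.

Section FreeMonoid.
Variable K : choiceType.

Fact fword_unit (x y : fword K) : x ++ y = [::] -> x = [::] /\ y = [::].
Proof. by case: x => // /= ->. Qed.

HB.instance Definition _ := Choice.on (fword K).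
HB.instance Definition _ :=
  Choice_isMonomialDef.Build (fword K)
    (@catA K) (@cat0s K) (@cats0 K) fword_unit.

End FreeMonoid.

Section LinearExtension.
Variables (C : nzRingType) (K : choiceType) (V : lmodType C).

Definition linext (f : K -> V) (a : {malg C[K]}) : V :=
  \sum_(k <- msupp a) a@_k *: f k.

End LinearExtension.

Section TensorAlgebra.
Variables (R : realType) (gT : finGroupType) (n : nat) (s : 'I_n -> gT).

Local Notation P := (posroot R s).
Local Notation word := (fword P).

(* T(V_W): since the x_a with a positive form a basis of V_W, this is the free
   associative algebra on the positive roots. *)
Local Notation T := {malg R[i][word]}.
(* T(V_W) (x) T(V_W), as a vector space. *)
Local Notation TT := {malg R[i][(word * word)%type]}.

Definition mono (k : word) : T := << k >>.

Definition xpos (a : P) : T := mono [:: a].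

(* x_a for an arbitrary root [a], using x_(-a) = - x_a. *)
Definition xroot (a : 'rV[R]_n) : T :=
  if insub a is Some p then xpos p
  else if insub (- a) is Some p then - xpos p else 0.

Definition wact (u : gT) : T -> T :=
  linext (fun k : word => \prod_(a <- k) xroot (geom_act s u (val a))).

Definition wdeg (k : word) : gT := (\prod_(a <- k) root_refl s (val a))%g.

Definition hpart (m : nat) : T -> T :=
  linext (fun k : word => if size k == m then mono k else 0).

(* The braiding applied to the tensor factors in positions i and i+1, counted
   from 0. *)
Definition braid (i : nat) : T -> T :=
  linext (fun k : word =>
    if drop i k is a :: b :: q then
      mono (take i k) * wact (root_refl s (val a)) (xpos b) * xpos a * mono q
    else mono k).

Definition adj_transp (m : nat) (i : 'I_m) : {perm 'I_m.+1} :=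
  tperm (widen_ord (leqnSn m) i) (lift ord0 i).

(* The braided factorial [m]!. Permutations of {0..m-1} compose from left to
   right here; with the other convention the reduced words of sigma become
   those of sigma^-1, which does not change the sum. *)
Definition braided_fact (m : nat) (a : T) : T :=
  if m is m'.+1 then
    \sum_(sigma : {perm 'I_m'.+1})
      foldr (fun i : 'I_m' => braid i) a (red_word (@adj_transp m') sigma)
  else a.

(* The ideal (+)_m ker [m]!. *)
Definition nichols_ideal (a : T) : Prop :=
  forall m, braided_fact m (hpart m a) = 0.

(* Equality in the Nichols algebra T(V_W) / (+)_m ker [m]! of the classes of
   two elements of T(V_W). *)
Definition nichols_eq (a b : T) : Prop := nichols_ideal (a - b).

Definition tens (a b : T) : TT :=
  \sum_(k <- msupp a) \sum_(l <- msupp b) << a@_k * b@_l *g (k, l) >>.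

(* (a (x) b) (c (x) d) = a (g c) (x) b d for b of W-degree g. *)
Definition twisted_mul (z t : TT) : TT :=
  \sum_(p <- msupp z) \sum_(q <- msupp t)
    (z@_p * t@_q) *:
      tens (mono p.1 * wact (wdeg p.2) (mono q.1)) (mono p.2 * mono q.2).

Definition coproduct : T -> TT :=
  linext (fun k : word =>
    foldr (fun a => twisted_mul (tens (xpos a) 1 + tens 1 (xpos a)))
      (tens 1 1) k).

(* The kernel I (x) T + T (x) I of T (x) T -> B (x) B, where I is the ideal
   above and B = T / I. *)
Definition nichols_ideal2 (z : TT) : Prop :=
  exists2 l : seq (T * T),
    (forall p, p \in l -> nichols_ideal p.1 \/ nichols_ideal p.2) &
    z = \sum_(p <- l) tens p.1 p.2.

Definition nichols_eq2 (z t : TT) : Prop := nichols_ideal2 (z - t).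

(* rho; it preserves the ideal, hence descends to the Nichols algebra. *)
Definition rho : T -> T := linext (fun k : word => mono (rev k)).

Definition xelt (w : gT) : T :=
  \prod_(i <- red_word s w) xroot (simple_root R i).

(* [f] is a family of representatives of the elements x_{w/v}, v in W. *)
Definition is_skew_family (w : gT) (f : {ffun gT -> T}) : Prop :=
  nichols_eq2 (coproduct (xelt w))
    (\sum_(v | bruhat s v w) tens (f v) (xelt v))
  /\ (forall v, ~~ bruhat s v w -> f v = 0).

(* A representative in T(V_W) of x_{w/v}; its class in the Nichols algebra is
   uniquely determined. *)
Definition xskew (w v : gT) : T :=
  xget [ffun=> 0] [set f | is_skew_family w f]%classic v.

Definition xskew_circ (w v : gT) : T := rho (xskew w^-1 v^-1)%g.

End TensorAlgebra.

(* Main.v *)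
(* The coefficient of a monomial g in the braided factorial of a monomial k in
   root vectors is a pairing <g, k> computed by successively extracting letters
   of k to the left (dual skew derivations).  An element lies in the ideal iff
   it pairs to 0 with every g; this makes stability of the ideal under W, left
   multiplication and rho, and the linear independence of the x_w, elementary.

   Comparing coproducts, x_{w/v} obeys the recursion, for w = s_i w' > w',
     x_{w/v} = x_i x_{w'/v} + [s_i v < v] s_i(x_{w'/s_i v}).
   By induction x_{w/v} = x_d with w = r_d v in length one, and x_{w/v} = x_a x_c
   with w = r_a r_c v in length two.  The only delicate case is that both terms
   are nonzero, with w' = r_d v: sign considerations force the angle of d and
   the simple root a_i to be 2 pi / 3, and the second term is
   s_i(x_d x_i) = - x_(d + a_i) x_i, so that the rank two relation
   x_i x_d = x_d x_(d + a_i) + x_(d + a_i) x_i leaves one monomial. *)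
From HB Require Import structures.
Require Import Defs.
From mathcomp Require Import all_boot all_order all_fingroup all_algebra.
From mathcomp Require Import finmap.
From mathcomp.multinomials Require Import monalg.
From mathcomp.real_closed Require Import complex.
From mathcomp Require Import boolp classical_sets reals trigo.
From mathcomp Require Import zify ring lra.
Set Implicit Arguments.
Unset Strict Implicit.
Unset Printing Implicit Defensive.
Import Order.TTheory GRing.Theory Num.Theory.
Local Open Scope ring_scope.

(** * Words and lengths *)

(** Words are taken in all roots, not only in the positive ones. There the braiding is a mere
    rearrangement of letters, and the relation x_(-a) = - x_a is confined to the coefficients +1 and
    -1 of the pairing; identities that are odd in every letter then pass between the two kinds of
    words. The obstacle in length two is that w = r_a r_c v does not determine the pair (a, c): if
    d, b and d + b are positive roots of a rank two subsystem, then r_d r_b = r_b r_(d+b) = r_(d+b)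
    r_d, and the three monomials differ in the algebra. The induction therefore carries a sign
    condition: whenever a and c differ by a positive root z, the inverse of v makes z negative. If
    the inverse of v keeps d and b positive, only (d, b) passes this test, and that is the situation
    met in the delicate case. Rank two arguments need to know that B is 0, 1/2 or -1/2 on roots that
    are neither equal nor opposite. The values are integral after doubling because W is simply
    laced, and bounded because the finite group W preserves an averaged scalar product. *)

Section WordTheory.
Local Open Scope group_scope.
Variables (gT : finGroupType) (I : choiceType) (s : I -> gT).

Lemma word_prod0 : word_prod s [::] = 1.
Proof. exact: big_nil. Qed.

Lemma word_prod_cons i e : word_prod s (i :: e) = s i * word_prod s e.
Proof. exact: big_cons. Qed.

Lemma word_prod_cat e1 e2 : word_prod s (e1 ++ e2) = word_prod s e1 * word_prod s e2.
Proof. exact: big_cat. Qed.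

Hypothesis gen : forall g, exists e, word_prod s e = g.

(** Descending to shorter words for g until none is left shows that the set given to [xget] is
    inhabited, so its default value is never returned. *)
Lemma red_wordP g : word_prod s (red_word s g) = g /\ reduced s (red_word s g).
Proof.
have [e he] := gen g.
suff [e0 [h1 h2]] : exists e0, word_prod s e0 = g /\ reduced s e0.
  rewrite /red_word; have := @xgetI _ [::] [set e | word_prod s e = g /\ reduced s e]%classic e0.
  by apply.
have [k] := ubnP (size e); elim: k e he => // k IHk e he hs.
have [[e' [h1 h2]]|h] :=
  pselect (exists e', word_prod s e' = g /\ (size e' < size e)%N).
  by apply: (IHk e' h1); lia.
exists e; split=> // e' he'; rewrite leqNgt; apply/negP => hlt.
by apply: h; exists e'; rewrite he' he.
Qed.

Lemma word_prod_red g : word_prod s (red_word s g) = g.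
Proof. by have [] := red_wordP g. Qed.

Lemma len_word_prod e : (len s (word_prod s e) <= size e)%N.
Proof.
have [h1 h2] := red_wordP (word_prod s e).
by rewrite /len; apply: h2; rewrite h1.
Qed.

Lemma reduced_size e : reduced s e -> size e = len s (word_prod s e).
Proof.
move=> h; apply/eqP; rewrite eqn_leq len_word_prod andbT.
by rewrite /len; apply: h; rewrite word_prod_red.
Qed.

Lemma len1 : len s 1 = 0.
Proof. by have := len_word_prod [::]; rewrite word_prod0 /=; lia. Qed.

Lemma len_mull_le i g : (len s (s i * g) <= (len s g).+1)%N.
Proof.
rewrite -{1}(word_prod_red g) -word_prod_cons.
exact: len_word_prod.
Qed.

Lemma reduced_behead i e : reduced s (i :: e) -> reduced s e.
Proof.
move=> h e' he'; have := h (i :: e'); rewrite !word_prod_cons he' /=.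
by move=> /(_ erefl); lia.
Qed.

Hypothesis s2 : forall i, s i * s i = 1.

Lemma invs i : (s i)^-1 = s i.
Proof. by apply/eqP; rewrite eq_invg_mul s2. Qed.

Lemma mulsK i g : s i * (s i * g) = g.
Proof. by rewrite mulgA s2 mul1g. Qed.

Lemma mulKs i g : g * s i * s i = g.
Proof. by rewrite -mulgA s2 mulg1. Qed.

Lemma word_prod_rev e : word_prod s (rev e) = (word_prod s e)^-1.
Proof.
elim: e => [|i e IHe]; first by rewrite word_prod0 invg1.
rewrite rev_cons -cats1 word_prod_cat IHe word_prod_cons word_prod_cons word_prod0.
by rewrite mulg1 invMg invs.
Qed.

Lemma lenV g : len s g^-1 = len s g.
Proof.
have hle h : (len s h^-1 <= len s h)%N.
  rewrite -{1}(word_prod_red h) -word_prod_rev.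
  by apply: leq_trans (len_word_prod _) _; rewrite size_rev.
by apply/eqP; rewrite eqn_leq hle -{1}(invgK g) hle.
Qed.

Lemma len_mulr_le i g : (len s (g * s i) <= (len s g).+1)%N.
Proof. by rewrite -lenV invMg invs -(lenV g) len_mull_le. Qed.

Lemma len_mulr_ge i g : (len s g <= (len s (g * s i)).+1)%N.
Proof. by rewrite -{1}(mulKs i g) len_mulr_le. Qed.

End WordTheory.

(** * A group of invertible matrices, as a target for the universal property *)

Section InvertiblePairs.
Variables (R : realType) (n : nat).

(* Row vectors are acted on from the right, so the product is reversed. *)
Definition mxpair : Type :=
  {p : 'M[R]_n * 'M[R]_n | (p.1 *m p.2 == 1%:M) && (p.2 *m p.1 == 1%:M)}.

HB.instance Definition _ := SubChoice.on mxpair.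

Fact mxpair_one_subproof :
  ((1%:M : 'M[R]_n) *m 1%:M == 1%:M) && ((1%:M : 'M[R]_n) *m 1%:M == 1%:M).
Proof. by rewrite mulmx1 eqxx. Qed.

Definition mxpair_one : mxpair :=
  exist _ ((1%:M : 'M[R]_n), (1%:M : 'M[R]_n)) mxpair_one_subproof.

Fact mxpair_inv_subproof (p : mxpair) :
  ((val p).2 *m (val p).1 == 1%:M) && ((val p).1 *m (val p).2 == 1%:M).
Proof. by have := valP p; rewrite andbC. Qed.

Definition mxpair_inv (p : mxpair) : mxpair :=
  exist _ ((val p).2, (val p).1) (mxpair_inv_subproof p).

Fact mxpair_mul_subproof (p q : mxpair) :
  ((val q).1 *m (val p).1 *m ((val p).2 *m (val q).2) == 1%:M)
  && ((val p).2 *m (val q).2 *m ((val q).1 *m (val p).1) == 1%:M).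
Proof.
have /andP[/eqP h1 /eqP h2] := valP p; have /andP[/eqP h3 /eqP h4] := valP q.
rewrite mulmxA -(mulmxA (val q).1) h1 mulmx1 h3 eqxx /=.
by rewrite mulmxA -(mulmxA (val p).2) h4 mulmx1 h2 eqxx.
Qed.

Definition mxpair_mul (p q : mxpair) : mxpair :=
  exist _ ((val q).1 *m (val p).1, (val p).2 *m (val q).2)
    (mxpair_mul_subproof p q).

Lemma mxpair_eq (p q : mxpair) : (val p).1 = (val q).1 -> p = q.
Proof.
move=> h1; apply: val_inj; apply: injective_projections => //.
have /andP[/eqP hp hp'] := valP p; have /andP[/eqP hq /eqP hq'] := valP q.
have e : (val q).2 *m (val q).1 *m (val p).2 = (val q).2.
  by rewrite -mulmxA -h1 hp mulmx1.
by rewrite -e hq' mul1mx.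
Qed.

Fact mxpair_mulA : associative mxpair_mul.
Proof. by move=> p q r; apply: mxpair_eq; rewrite /= mulmxA. Qed.
Fact mxpair_mul1 : left_id mxpair_one mxpair_mul.
Proof. by move=> p; apply: mxpair_eq; rewrite /= mulmx1. Qed.
Fact mxpair_mul1r : right_id mxpair_one mxpair_mul.
Proof. by move=> p; apply: mxpair_eq; rewrite /= mul1mx. Qed.
Fact mxpair_mulV : left_inverse mxpair_one mxpair_inv mxpair_mul.
Proof. by move=> p; apply: mxpair_eq => /=; have /andP[/eqP] := valP p. Qed.
Fact mxpair_mulVr : right_inverse mxpair_one mxpair_inv mxpair_mul.
Proof. by move=> p; apply: mxpair_eq => /=; have /andP[_ /eqP] := valP p. Qed.

HB.instance Definition _ := isGroup.Build mxpair
  mxpair_mulA mxpair_mul1 mxpair_mul1r mxpair_mulV mxpair_mulVr.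

End InvertiblePairs.

(** * Roots *)

(** For 3x = pi and c = cos x the triple angle formula reads 4c^3 - 3c + 1 = (c + 1)(2c - 1)^2 = 0,
    and c is positive. *)
Lemma cos_pi3 (R : realType) : cos (pi / 3%:R : R) = 2^-1.
Proof.
set x : R := pi / 3%:R; have hx : x *+ 2 + x = pi by rewrite /x; lra.
have h : cos (x *+ 2 + x) = -1 by rewrite hx cospi.
rewrite cosD cos_mulr2n sin_mulr2n in h.
have hcs := cos2Dsin2 x.
have hc : 0 < cos x.
  by apply: cos_gt0_pihalf; have := pi_gt0 R; rewrite /x; lra.
have : (cos x + 1) * (2 * cos x - 1) ^+ 2 = 0.
  have hs : sin x ^+ 2 = 1 - cos x ^+ 2 by lra.
  have e : cos x * sin x *+ 2 * sin x = 2 * cos x * (1 - cos x ^+ 2).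
    by rewrite -hs; ring.
  rewrite e in h.
  have -> : (cos x + 1) * (2 * cos x - 1) ^+ 2 =
     (cos x ^+ 2 *+ 2 - 1) * cos x - 2 * cos x * (1 - cos x ^+ 2) + 1 by ring.
  by rewrite h; ring.
move/eqP; rewrite mulf_eq0 expf_eq0 /= => /orP[/eqP|/eqP]; lra.
Qed.

(** * The geometric representation *)

Section Geometry.
Variables (R : realType) (gT : finGroupType) (n : nat) (s : 'I_n -> gT).
Hypothesis hW : simply_laced_weyl_group s.

Local Notation V := 'rV[R]_n.
Local Notation B := (@bform R gT n s).
Local Notation "''a_' i" := (@simple_root R n i) (at level 8, i at level 2, format "''a_' i").
Local Notation act := (@geom_act R gT n s).

Lemma coxeter_gen g : exists e, word_prod s e = g.
Proof.
have [[_ _ hgen _] _ _] := hW.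
have : g \in <<[set s i | i in 'I_n]>>%g by rewrite hgen inE.
case/gen_prodgP => k [c hc ->] {g}.
elim: k c hc => [|k IHk] c hc; first by exists [::]; rewrite word_prod0 big_ord0.
have [e he] := IHk (fun i => c (lift ord0 i)) (fun i => hc _).
have /imsetP[i _ hi] := hc ord0.
by exists (i :: e); rewrite word_prod_cons big_ord_recl he hi.
Qed.

Lemma coxeter_invol i : (s i * s i = 1)%g.
Proof.
have [[_ h _ _] _ _] := hW.
by have := expg_order (s i); rewrite h !expgS expg0 mulg1.
Qed.

Let gen := coxeter_gen.
Let s2 := coxeter_invol.

Lemma cox_m_eq1 i j : (cox_m s i j == 1)%N = (i == j).
Proof.
have [[hinj _ _ _] _ _] := hW.
rewrite /cox_m order_eq1 -eq_invg_mul (invs s2).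
by apply/eqP/eqP => [/hinj|->].
Qed.

Lemma gram_diag i : gram R s i i = 1.
Proof.
have /eqP h : cox_m s i i == 1 by rewrite cox_m_eq1.
by rewrite mxE h divr1 cospi opprK.
Qed.

Lemma gram_sym i j : gram R s i j = gram R s j i.
Proof.
rewrite !mxE /cox_m; suff -> : #[s i * s j]%g = #[s j * s i]%g by [].
by rewrite -orderV invMg !(invs s2).
Qed.

(** The order of s_i s_j is 2 or 3. Each value of the form is paired with the commutation or braid
    relation that goes with it, since length comparisons use both at once. *)
Lemma gram_offdiag i j : i != j ->
  (gram R s i j = 0 /\ (s i * s j = s j * s i)%g) \/
  (gram R s i j = - 2^-1 /\ (s i * s j * s i = s j * s i * s j)%g).
Proof.
move=> hij; have [_ _ /(_ i j) hle] := hW.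
have h1 := cox_m_eq1 i j; rewrite (negPf hij) in h1.
have hgt : (0 < cox_m s i j)%N by exact: order_gt0.
have hx := expg_order (s i * s j).
rewrite mxE; rewrite -/(cox_m s i j) in hx.
have [h2|h3] : cox_m s i j = 2 \/ cox_m s i j = 3 by move/eqP: h1; lia.
- left; rewrite h2 in hx *; rewrite cos_pihalf oppr0; split=> //.
  move: hx; rewrite !expgS expg0 mulg1 => /eqP; rewrite -eq_invg_mul => /eqP <-.
  by rewrite invMg !(invs s2).
- right; rewrite h3 in hx *; rewrite cos_pi3; split=> //.
  move: hx; rewrite !expgS expg0 mulg1 => h.
  have : (s i * s j * s i * (s j * s i * s j) = 1)%g by rewrite -h !mulgA.
  move/eqP; rewrite -eq_invg_mul => /eqP <-.
  by rewrite !invMg !(invs s2) mulgA.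
Qed.

Lemma bformE x y : B x y = \sum_i \sum_j x 0 i * gram R s i j * y 0 j.
Proof.
rewrite /bform mxE exchange_big /=; apply: eq_bigr => j _.
rewrite mxE mulr_suml; apply: eq_bigr => i _.
by rewrite [y^T _ _]mxE.
Qed.

Lemma bformC x y : B x y = B y x.
Proof.
rewrite !bformE exchange_big; apply: eq_bigr => i _; apply: eq_bigr => j _ /=.
by rewrite gram_sym; ring.
Qed.

Lemma bformDl x y z : B (x + y) z = B x z + B y z.
Proof. by rewrite /bform !mulmxDl mxE. Qed.
Lemma bformZl c x z : B (c *: x) z = c * B x z.
Proof. by rewrite /bform -!scalemxAl mxE. Qed.
Lemma bformNl x z : B (- x) z = - B x z.
Proof. by rewrite -scaleN1r bformZl mulN1r. Qed.
Lemma bformBl x y z : B (x - y) z = B x z - B y z.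
Proof. by rewrite bformDl bformNl. Qed.
Lemma bformDr x y z : B z (x + y) = B z x + B z y.
Proof. by rewrite !(bformC z) bformDl. Qed.
Lemma bformZr c x z : B z (c *: x) = c * B z x.
Proof. by rewrite !(bformC z) bformZl. Qed.
Lemma bformNr x z : B z (- x) = - B z x.
Proof. by rewrite !(bformC z) bformNl. Qed.
Lemma bformBr x y z : B z (x - y) = B z x - B z y.
Proof. by rewrite !(bformC z) bformBl. Qed.
Definition bformL := (bformDl, bformBl, bformNl, bformZl, bformDr, bformBr, bformNr, bformZr).

Lemma simple_rootE i k : 'a_i 0 k = (k == i)%:R.
Proof. by rewrite mxE eqxx. Qed.

Lemma bform_simple i j : B 'a_i 'a_j = gram R s i j.
Proof.
rewrite /bform -rowE mxE (bigD1 j) //= !mxE !eqxx mulr1 big1 ?addr0 // => k hk.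
by rewrite !mxE eqxx (negPf hk) mulr0.
Qed.

Lemma bform_simple_r x j : B x 'a_j = \sum_i x 0 i * gram R s i j.
Proof.
rewrite bformE; apply: eq_bigr => i _; rewrite (bigD1 j) //= simple_rootE eqxx mulr1.
by rewrite big1 ?addr0 // => k hk; rewrite simple_rootE (negPf hk) mulr0.
Qed.

Definition refl (a x : V) : V := x - (2 * B x a) *: a.

Lemma reflE a x : refl a x = x - (2 * B x a) *: a.
Proof. by []. Qed.

Lemma simple_reflE i x : simple_refl s i x = refl 'a_i x.
Proof. by []. Qed.

Lemma reflD a x y : refl a (x + y) = refl a x + refl a y.
Proof. by rewrite /refl bformDl; apply/rowP => k; rewrite !mxE; ring. Qed.
Lemma reflZ a c x : refl a (c *: x) = c *: refl a x.
Proof. by rewrite /refl bformZl; apply/rowP => k; rewrite !mxE; ring. Qed.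
Lemma reflN a x : refl a (- x) = - refl a x.
Proof. by rewrite -scaleN1r reflZ scaleN1r. Qed.
Lemma reflNl a x : refl (- a) x = refl a x.
Proof. by rewrite /refl bformNr; apply/rowP => k; rewrite !mxE; ring. Qed.
Lemma bform_refl_l a x y : B (refl a x) y = B x y - 2 * B x a * B a y.
Proof. by rewrite /refl bformBl bformZl. Qed.

Section Unit.
Variable a : V.
Hypothesis ha : B a a = 1.
Lemma refl_self : refl a a = - a.
Proof. by rewrite /refl ha; apply/rowP => k; rewrite !mxE; ring. Qed.
Lemma reflK x : refl a (refl a x) = x.
Proof.
rewrite {1}/refl bform_refl_l ha /refl; apply/rowP => k; rewrite !mxE; ring.
Qed.
Lemma bform_refl x y : B (refl a x) (refl a y) = B x y.
Proof.
by rewrite bform_refl_l !(bformC _ (refl a y)) !bform_refl_l ha (bformC y x) (bformC y a) (bformC x a); ring.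
Qed.
Lemma refl_refl x y : refl (refl a x) (refl a y) = refl a (refl x y).
Proof. by rewrite {1}/refl bform_refl [refl x y]/refl -!scaleNr reflD reflZ. Qed.
End Unit.

Lemma bform_aa i : B 'a_i 'a_i = 1.
Proof. by rewrite bform_simple gram_diag. Qed.

Definition refl_mx i : 'M[R]_n := lin1_mx (refl 'a_i).

Lemma mul_refl_mx i (x : V) : x *m refl_mx i = refl 'a_i x.
Proof.
apply/rowP => k; rewrite mxE.
have hlin : linear (refl 'a_i) by move=> c u v; rewrite reflD reflZ.
have := (mul_rV_lin1 (HB.pack_for {linear V -> V} (refl 'a_i) (GRing.isLinear.Build _ _ _ _ _ hlin)) x).
by move/rowP/(_ k); rewrite mxE.
Qed.

Lemma mx_rowP (M N : 'M[R]_n) : (forall x : V, x *m M = x *m N) -> M = N.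
Proof. by move=> h; apply/row_matrixP => i; rewrite !rowE h. Qed.

Fact refl_mx_subproof i :
  (refl_mx i *m refl_mx i == 1%:M) && (refl_mx i *m refl_mx i == 1%:M).
Proof.
rewrite andbb; apply/eqP/mx_rowP => x.
by rewrite mulmxA !mul_refl_mx reflK ?bform_aa // mulmx1.
Qed.

Definition refl_pair i : mxpair R n := exist _ (refl_mx i, refl_mx i) (refl_mx_subproof i).

Lemma refl_pair_cox i j : ((refl_pair i * refl_pair j) ^+ cox_m s i j = 1)%g.
Proof.
apply: mxpair_eq; apply: mx_rowP => x.
have hmul (p q : mxpair R n) : x *m (val (p * q)%g).1 = x *m (val q).1 *m (val p).1 by rewrite mulmxA.
have [->|hij] := eqVneq i j.
  have /eqP -> : cox_m s j j == 1 by rewrite cox_m_eq1.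
  by rewrite expg1 /= mulmxA !mul_refl_mx reflK ?bform_aa // mulmx1.
have hgt : (0 < cox_m s i j)%N by exact: order_gt0.
have h1 := cox_m_eq1 i j; rewrite (negPf hij) in h1.
have [_ _ /(_ i j) hle] := hW.
have [h|h] : cox_m s i j = 2 \/ cox_m s i j = 3 by move/eqP: h1; lia.
- have g0 : B 'a_i 'a_j = 0 by rewrite bform_simple mxE h cos_pihalf oppr0.
  rewrite h !expgS expg0 mulg1 /= !mulmxA !mul_refl_mx mulmx1.
  rewrite /refl !bformL (bformC 'a_j) !g0 !bform_aa; apply/rowP => k; rewrite !mxE; ring.
- have g0 : B 'a_i 'a_j = - 2^-1 by rewrite bform_simple mxE h cos_pi3.
  rewrite h !expgS expg0 mulg1 /= !mulmxA !mul_refl_mx mulmx1.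
  rewrite /refl !bformL (bformC 'a_j) !g0 !bform_aa; apply/rowP => k; rewrite !mxE.
  set u := B x 'a_i; set v := B x 'a_j; by field.
Qed.

(** The homomorphism F given by the universal property computes the composite reflection from the
    product of the word alone. Hence [geom_act] does not depend on the reduced word that [red_word]
    selects. *)
Lemma foldr_simple_refl e e' (x : V) : word_prod s e = word_prod s e' ->
  foldr (simple_refl s) x e = foldr (simple_refl s) x e'.
Proof.
have [[_ _ _ huniv] _ _] := hW.
have [F [hF hFs]] := huniv _ _ refl_pair_cox.
suff hf : forall f, foldr (simple_refl s) x f = x *m (val (F (word_prod s f))).1.
  by rewrite !hf => ->.
elim=> [|i f IHf] /=.
  have h1 : F 1%g = 1%g by apply: (mulgI (F 1%g)); rewrite -hF !mulg1.
  by rewrite word_prod0 h1 /= mulmx1.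
by rewrite IHf word_prod_cons hF hFs /= mulmxA mul_refl_mx.
Qed.

Lemma geom_act_word e x : act (word_prod s e) x = foldr (simple_refl s) x e.
Proof. by apply: foldr_simple_refl; rewrite (word_prod_red gen). Qed.

End Geometry.

(** * Signs of roots and the length function *)

Section Roots.
Variables (R : realType) (gT : finGroupType) (n : nat) (s : 'I_n -> gT).
Hypothesis hW : simply_laced_weyl_group s.

Local Notation V := 'rV[R]_n.
Local Notation B := (@bform R gT n s).
Local Notation "''a_' i" := (@simple_root R n i) (at level 8, i at level 2, format "''a_' i").
Local Notation act := (@geom_act R gT n s).
Local Notation refl := (@refl R gT n s).

Let gen := coxeter_gen hW.
Let s2 := coxeter_invol hW.

Lemma geom_act1 x : act 1 x = x.
Proof. by rewrite -(word_prod0 s) geom_act_word. Qed.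

Lemma geom_actM g h x : act (g * h) x = act g (act h x).
Proof.
have [e <-] := gen g; have [f <-] := gen h.
by rewrite -word_prod_cat !geom_act_word // foldr_cat.
Qed.

Lemma geom_act_s i x : act (s i) x = refl 'a_i x.
Proof.
have -> : s i = word_prod s [:: i] by rewrite word_prod_cons word_prod0 mulg1.
by rewrite geom_act_word.
Qed.

Lemma geom_actKV g x : act g (act g^-1 x) = x.
Proof. by rewrite -geom_actM mulgV geom_act1. Qed.
Lemma geom_actVK g x : act g^-1 (act g x) = x.
Proof. by rewrite -geom_actM mulVg geom_act1. Qed.

Lemma geom_actD g x y : act g (x + y) = act g x + act g y.
Proof.
have [e <-] := gen g; rewrite !geom_act_word //.
by elim: e => //= i e ->; rewrite simple_reflE reflD.
Qed.

Lemma geom_actZ g c x : act g (c *: x) = c *: act g x.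
Proof.
have [e <-] := gen g; rewrite !geom_act_word //.
by elim: e => //= i e ->; rewrite simple_reflE reflZ.
Qed.

Lemma geom_actN g x : act g (- x) = - act g x.
Proof. by rewrite -scaleN1r geom_actZ scaleN1r. Qed.

Lemma geom_actB g x y : act g (x - y) = act g x - act g y.
Proof. by rewrite geom_actD geom_actN. Qed.

Lemma bform_act g x y : B (act g x) (act g y) = B x y.
Proof.
have [e <-] := gen g; rewrite !geom_act_word //.
by elim: e => //= i e <-; rewrite !simple_reflE bform_refl // bform_aa.
Qed.

Lemma bform_actl g x y : B (act g x) y = B x (act g^-1 y).
Proof. by rewrite -{1}(geom_actKV g y) bform_act. Qed.

Lemma geom_act_refl g x y : act g (refl x y) = refl (act g x) (act g y).
Proof. by rewrite /refl bform_act geom_actB geom_actZ. Qed.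

(** Sending every generator to the transposition of [bool] satisfies the relations and yields the
    sign character of W. It rules out equal lengths of g and g s_i. *)
Lemma odd_len e : odd (len s (word_prod s e)) = odd (size e).
Proof.
have [[_ _ _ huniv] _ _] := hW.
pose c : {perm bool} := tperm true false.
have hc i j : ((c * c) ^+ cox_m s i j = 1)%g by rewrite tperm2 expg1n.
have [F [hF hFs]] := huniv _ (fun=> c) hc.
have hodd f : odd_perm (F (word_prod s f)) = odd (size f).
  elim: f => [|i f IHf] /=.
    have h1 : F 1%g = 1%g by apply: (mulgI (F 1%g)); rewrite -hF !mulg1.
    by rewrite word_prod0 h1 odd_perm1.
  by rewrite word_prod_cons hF hFs odd_permM odd_tperm IHf.
by rewrite -hodd -{2}(word_prod_red gen (word_prod s e)) hodd.
Qed.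

Lemma odd_lenM g h : odd (len s (g * h)) = odd (len s g) (+) odd (len s h).
Proof.
have [e <-] := gen g; have [f <-] := gen h.
by rewrite -word_prod_cat !odd_len size_cat oddD.
Qed.

Lemma odd_len_s i : odd (len s (s i)).
Proof. by have := odd_len [:: i]; rewrite word_prod_cons word_prod0 mulg1 => ->. Qed.

Lemma len_mulr_cases g i :
  len s (g * s i) = (len s g).+1 \/ len s g = (len s (g * s i)).+1.
Proof.
have h1 := len_mulr_le gen s2 i g; have h2 := len_mulr_ge gen s2 i g.
have h3 := odd_lenM g (s i); rewrite odd_len_s in h3.
by lia.
Qed.

Definition nneg (x : V) : bool := [forall i, 0 <= x 0 i].

Lemma nnegP (x : V) : reflect (forall i, 0 <= x 0 i) (nneg x).
Proof. exact: forallP. Qed.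

Lemma nnegD x y : nneg x -> nneg y -> nneg (x + y).
Proof. by move=> /nnegP hx /nnegP hy; apply/nnegP => i; rewrite mxE addr_ge0. Qed.

Lemma nneg_simple i : nneg 'a_i.
Proof. by apply/nnegP => k; rewrite simple_rootE ler0n. Qed.

Lemma refl_simple i j :
  refl 'a_j 'a_i = 'a_i - (2 * gram R s i j) *: 'a_j.
Proof. by rewrite /refl bform_simple. Qed.

Lemma exists_descent (g : gT) : g <> 1%g -> exists j, len s g = (len s (g * s j)).+1.
Proof.
move=> hg1; have [hg e_red] := red_wordP gen g.
have hsz := reduced_size gen e_red; rewrite hg in hsz.
move: hg hsz; have [|f j] := lastP (red_word s g).
  by rewrite word_prod0 => /esym.
rewrite -cats1 word_prod_cat word_prod_cons word_prod0 mulg1 size_cat addn1 => hg hsz.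
exists j; have [h|//] := len_mulr_cases g j.
have := len_word_prod gen f.
by rewrite -{1}(mulKs s2 j (word_prod s f)) hg h -hsz; lia.
Qed.

(* Induction on the length: if s_j is a right descent of g, compare g with the
   shortest element of its coset modulo the parabolic subgroup <s_i, s_j>. *)
Lemma ascent_nneg g i : (len s g < len s (g * s i))%N -> nneg (act g 'a_i).
Proof.
have [k] := ubnP (len s g); elim: k g i => // k IHk g i hk hasc.
have [->|/eqP hg1] := eqVneq g 1%g; first by rewrite geom_act1 nneg_simple.
have [j hj] := exists_descent hg1.
have [hij|hij] := eqVneq i j; first by rewrite hij in hasc; lia.
set x := (g * s j)%g in hj; have hg : g = (x * s j)%g by rewrite mulKs.
rewrite hg geom_actM geom_act_s refl_simple.
have [[h0 hc]|[h0 hb]] := gram_offdiag R hW hij; rewrite h0.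
  rewrite mulr0 scale0r subr0; apply: IHk; first by lia.
  have -> : (x * s i)%g = (g * s i * s j)%g by rewrite /x -!mulgA hc.
  by have := len_mulr_ge gen s2 j (g * s i); have := len_mulr_cases g i; lia.
have -> : 'a_i - (2 * - 2^-1) *: 'a_j = 'a_i + 'a_j.
  by rewrite mulrN mulfV ?pnatr_eq0 // scaleN1r opprK.
have hxj : nneg (act x 'a_j) by apply: IHk; rewrite -?hg; lia.
have [hxi|hxi] := len_mulr_cases x i.
  by rewrite geom_actD nnegD // IHk //; lia.
set y := (x * s i)%g in hxi; have hx : x = (y * s i)%g by rewrite mulKs.
rewrite hx geom_actM geom_act_s.
have -> : refl 'a_i ('a_i + 'a_j) = 'a_j.
  rewrite reflD refl_self ?bform_aa // refl_simple (gram_sym R hW) h0.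
  by rewrite mulrN mulfV ?pnatr_eq0 // scaleN1r opprK addrC addrK.
apply: IHk; first by lia.
have [h|h] := len_mulr_cases y j; first by lia.
(* If s_j were a descent of y, the braid relation would give g s_i a length of at most that of y
   plus one, whereas g already has the length of y plus two. *)
have : (len s (g * s i) <= (len s (y * s j)).+2)%N.
  have -> : (g * s i)%g = (y * s j * s i * s j)%g by rewrite hg hx -!mulgA !mulgA -!(mulgA y) hb.
  by apply: leq_trans (len_mulr_le gen s2 _ _) _; rewrite ltnS (len_mulr_le gen s2).
have := len_mulr_cases g i; lia.
Qed.

Local Notation isroot := (@is_root R gT n s).
Local Notation posr := (@is_posroot R gT n s).

Lemma isrootP x : reflect (exists g i, x = act g 'a_i) (isroot x).
Proof.
apply: (iffP existsP) => [[g /existsP[i /eqP h]]|[g [i h]]]; exists g.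
  by exists i.
by apply/existsP; exists i; apply/eqP.
Qed.

Lemma isroot_act g x : isroot x -> isroot (act g x).
Proof. by case/isrootP => h [i ->]; apply/isrootP; exists (g * h)%g, i; rewrite geom_actM. Qed.

Lemma isroot_simple i : isroot 'a_i.
Proof. by apply/isrootP; exists 1%g, i; rewrite geom_act1. Qed.

Lemma isrootN x : isroot x -> isroot (- x).
Proof.
case/isrootP => h [i ->]; apply/isrootP; exists (h * s i)%g, i.
by rewrite geom_actM geom_act_s refl_self ?bform_aa // geom_actN.
Qed.

Lemma isrootNE x : isroot (- x) = isroot x.
Proof. by apply/idP/idP => /isrootN //; rewrite opprK. Qed.

Lemma root_norm x : isroot x -> B x x = 1.
Proof. by case/isrootP => h [i ->]; rewrite bform_act bform_aa. Qed.

Lemma root_neq0 x : isroot x -> x != 0.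
Proof.
move/root_norm => h; apply/eqP => hx; move: h; rewrite hx.
by rewrite -(scale0r (0 : V)) bformZl mul0r => /eqP; rewrite eq_sym oner_eq0.
Qed.

Lemma posr_nnegE x : posr x = isroot x && nneg x.
Proof. by []. Qed.

Lemma posr_root x : posr x -> isroot x.
Proof. by case/andP. Qed.

Lemma posr_opp x : posr x -> ~~ posr (- x).
Proof.
move=> /andP[hx /nnegP h]; apply/negP => /andP[_ /nnegP h'].
case/eqP: (root_neq0 hx); apply/rowP => i; rewrite mxE; apply/eqP.
by rewrite eq_le h andbT -oppr_ge0; have := h' i; rewrite mxE.
Qed.

Lemma descent_neg g i : (len s (g * s i) < len s g)%N -> nneg (- act g 'a_i).
Proof.
move=> h; have := @ascent_nneg (g * s i)%g i.
by rewrite mulKs // => /(_ h); rewrite geom_actM geom_act_s refl_self ?bform_aa // geom_actN.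
Qed.

Lemma root_cases x : isroot x -> posr x \/ posr (- x).
Proof.
move=> hx; rewrite !posr_nnegE isrootNE hx /=; case/isrootP: hx => g [i ->].
have [h|h] := len_mulr_cases g i; first by left; rewrite ascent_nneg // h.
by right; rewrite descent_neg // h.
Qed.

Lemma npos_neg x : isroot x -> ~~ posr x -> posr (- x).
Proof. by move/root_cases => [->|]. Qed.

Lemma posr_oppE x : isroot x -> posr (- x) = ~~ posr x.
Proof.
move=> hx; apply/idP/idP => [h|]; last exact: npos_neg.
by have := posr_opp h; rewrite opprK.
Qed.

Lemma posr_simple i : posr 'a_i.
Proof. by rewrite posr_nnegE isroot_simple nneg_simple. Qed.

Lemma ascent_posr g i : posr (act g 'a_i) = (len s g < len s (g * s i))%N.
Proof.
have hr := isroot_act g (isroot_simple i).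
apply/idP/idP => [h|/ascent_nneg h]; last by rewrite posr_nnegE hr.
rewrite ltnNge; apply/negP => hle; have := posr_opp h.
by rewrite posr_nnegE isrootNE hr descent_neg //; have := len_mulr_cases g i; lia.
Qed.

(** A nontrivial g has a right descent, and it makes the corresponding simple root negative. *)
Lemma geom_act_faithful g : (forall x, act g x = x) -> g = 1%g.
Proof.
move=> h; apply: contrapT => /exists_descent[j hj].
by have := ascent_posr g j; rewrite h posr_simple; lia.
Qed.

Lemma geom_act_inj g h : (forall x, act g x = act h x) -> g = h.
Proof.
move=> e; apply/eqP; rewrite eq_mulVg1; apply/eqP/geom_act_faithful => x.
by rewrite geom_actM -e geom_actVK.
Qed.

Local Notation rr := (@root_refl R gT n s).

Lemma geom_act_rr x : isroot x -> forall y, act (rr x) y = refl x y.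
Proof.
move=> /isrootP[g [i hx]] y; rewrite /root_refl.
case: pickP => [[h j] /= /eqP hh|/(_ (g, i))]; last by rewrite /= hx eqxx.
by rewrite !geom_actM geom_act_s geom_act_refl hh geom_actKV.
Qed.

(** By faithfulness the arbitrary choice made in [root_refl] is immaterial: only the linear
    reflection counts. Identities between reflections in the group are all checked this way. *)
Lemma rr_uniq x g : isroot x -> (forall y, act g y = refl x y) -> g = rr x.
Proof. by move=> hx h; apply: geom_act_inj => y; rewrite h geom_act_rr. Qed.

Lemma rr_simple i : rr 'a_i = s i.
Proof. by apply/esym/rr_uniq => [|y]; rewrite ?isroot_simple ?geom_act_s. Qed.

Lemma rrN x : isroot x -> rr (- x) = rr x.
Proof. by move=> hx; apply: rr_uniq => // y; rewrite geom_act_rr ?isrootNE ?reflNl. Qed.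

Lemma rr_act g x : isroot x -> rr (act g x) = (g * rr x * g^-1)%g.
Proof.
move=> hx; apply/esym/rr_uniq => [|y]; first exact: isroot_act.
by rewrite !geom_actM geom_act_rr // geom_act_refl geom_actKV.
Qed.

Lemma rr2 x : isroot x -> (rr x * rr x = 1)%g.
Proof.
move=> hx; apply: geom_act_faithful => y.
by rewrite geom_actM !geom_act_rr // reflK // root_norm.
Qed.

Lemma rrV x : isroot x -> ((rr x)^-1 = rr x)%g.
Proof. by move=> hx; apply/eqP; rewrite eq_invg_mul rr2. Qed.

Lemma isroot_refl x y : isroot x -> isroot y -> isroot (refl x y).
Proof. by move=> hx hy; rewrite -geom_act_rr // isroot_act. Qed.

(** The reflection in y sends x to -x, so x is a multiple of y; equal norms and positivity leave the
    factor 1. *)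
Lemma rr_inj x y : posr x -> posr y -> rr x = rr y -> x = y.
Proof.
move=> hx hy e; have hx' := posr_root hx; have hy' := posr_root hy.
have := geom_act_rr hx' x; rewrite e geom_act_rr // refl_self ?root_norm //.
set b := 2 * B x y; rewrite /refl -/b => h.
have hxy : x = (b / 2) *: y.
  apply/rowP => k; move/rowP/(_ k): h; rewrite !mxE => h; lra.
have := root_norm hx'; rewrite hxy bformZl bformZr // root_norm // mulr1 => h2.
have : (b / 2 - 1) * (b / 2 + 1) = 0 by move: h2; set c := b / 2 => h2; ring: h2.
move/eqP; rewrite mulf_eq0 subr_eq0 addr_eq0 => /orP[/eqP ->|/eqP hc].
  by rewrite scale1r.
by have := posr_opp hy; rewrite -scaleN1r -hc -hxy hx.
Qed.

(** The reflection in ['a_i] changes the coordinate of index i only. A change of sign would force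
    all other coordinates of x to vanish. *)
Lemma posr_refl_simple x i : posr x -> x <> 'a_i -> posr (refl 'a_i x).
Proof.
move=> hx hne; have hx' := posr_root hx.
have [//|/andP[_ /nnegP h]] := root_cases (isroot_refl (isroot_simple i) hx').
case/andP: (hx) => _ /nnegP h0; case: hne.
have hc : x = x 0 i *: 'a_i.
  apply/rowP => k; rewrite mxE simple_rootE; have [->|hk] := eqVneq k i.
    by rewrite mulr1.
  rewrite mulr0; apply/eqP; rewrite eq_le h0 andbT.
  have := h k; rewrite !mxE (negPf hk) andbF mulr0.
  by rewrite oppr0 addr0 oppr_ge0.
have := root_norm hx'; rewrite hc bformZl bformZr // bform_aa // mulr1 => h1.
have : (x 0 i - 1) * (x 0 i + 1) = 0 by move: h1; set c := x 0 i => h1; ring: h1.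
move/eqP; rewrite mulf_eq0 subr_eq0 addr_eq0 => /orP[/eqP ->|/eqP hd].
  by rewrite scale1r.
by have := h0 i; rewrite hd oppr_ge0 ler10.
Qed.

(** The letters of e act on c one after the other. At the letter where the root turns negative it
    must be the simple root of that letter, and deleting this letter is multiplication by the
    reflection in c. *)
Lemma strong_exchange c e : posr c -> posr (- act (word_prod s e)^-1 c) ->
  exists2 f, (size f).+1 = size e & word_prod s f = (rr c * word_prod s e)%g.
Proof.
elim: e c => [|i e IHe] c hc.
  by rewrite word_prod0 invg1 geom_act1 (negPf (posr_opp hc)).
rewrite word_prod_cons invMg (invs s2) geom_actM geom_act_s => h.
have [hci|hci] := eqVneq c 'a_i.
  by exists e => //; rewrite hci rr_simple mulsK.
have hc' := posr_refl_simple hc (elimN eqP hci).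
have [f h1 h2] := IHe _ hc' h; exists (i :: f); first by rewrite /= h1.
rewrite word_prod_cons h2 -geom_act_s rr_act ?posr_root // (invs s2).
by rewrite !mulgA s2 mul1g.
Qed.

Lemma len_rr_lt c g : posr c -> posr (- act g^-1 c) -> (len s (rr c * g) < len s g)%N.
Proof.
move=> hc; case: (red_wordP gen g); move: (red_word s g) => e <- h2.
case/(strong_exchange hc) => f h3 <-; rewrite -(reduced_size gen h2) -h3.
by rewrite ltnS len_word_prod.
Qed.

(** This is the dictionary between lengths and signs of roots. One direction is strong exchange; the
    other applies it to r_c g, for which the sign of c is opposite. *)
Lemma len_rr c g : posr c -> posr (act g^-1 c) = (len s g < len s (rr c * g))%N.
Proof.
move=> hc; have hc' := posr_root hc; apply/idP/idP => h.
  have := @len_rr_lt c (rr c * g) hc; rewrite mulgA rr2 // mul1g; apply.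
  by rewrite invMg geom_actM rrV // geom_act_rr // refl_self ?root_norm // geom_actN opprK.
apply/negPn/negP => hn; have := len_rr_lt hc (npos_neg (isroot_act _ hc') hn).
by lia.
Qed.

End Roots.

(** * Angles between roots and factorizations of a rank two rotation *)

Section RankTwo.
Variables (R : realType) (gT : finGroupType) (n : nat) (s : 'I_n -> gT).
Hypothesis hW : simply_laced_weyl_group s.

Local Notation V := 'rV[R]_n.
Local Notation B := (@bform R gT n s).
Local Notation "''a_' i" := (@simple_root R n i) (at level 8, i at level 2, format "''a_' i").
Local Notation act := (@geom_act R gT n s).
Local Notation refl := (@refl R gT n s).
Local Notation isroot := (@is_root R gT n s).
Local Notation posr := (@is_posroot R gT n s).
Local Notation rr := (@root_refl R gT n s).

Let gen := coxeter_gen hW.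

Lemma gram_int i j : 2 * gram R s i j \is a Num.int.
Proof.
have [->|hij] := eqVneq i j; first by rewrite gram_diag // mulr1 (@intr_nat _ 2).
have [[-> _]|[-> _]] := gram_offdiag R hW hij; first by rewrite mulr0 int_num0.
by rewrite mulrN mulfV ?pnatr_eq0 // rpredN int_num1.
Qed.

Lemma bform_simple_int (x : V) j : (forall k, x 0 k \is a Num.int) -> 2 * B x 'a_j \is a Num.int.
Proof.
move=> hx; rewrite bform_simple_r mulr_sumr rpred_sum // => i _.
by rewrite mulrCA rpredM // gram_int.
Qed.

Lemma root_int (x : V) k : isroot x -> x 0 k \is a Num.int.
Proof.
case/isrootP => g [i ->]; have [e <-] := gen g; rewrite geom_act_word //.
elim: e k => [|j e IHe] k /=; first by rewrite simple_rootE; exact: intr_nat.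
set y := foldr _ _ _ in IHe *; rewrite simple_reflE.
have -> : refl 'a_j y 0 k = y 0 k - 2 * B y 'a_j * 'a_j 0 k by rewrite !mxE.
apply: rpredB => //; apply: rpredM; first exact: bform_simple_int.
by rewrite simple_rootE; exact: intr_nat.
Qed.

Lemma bform_root_int x y : isroot x -> isroot y -> 2 * B x y \is a Num.int.
Proof.
move=> hx /isrootP[g [i ->]]; rewrite bformC // bform_actl // bformC //.
by apply: bform_simple_int => k; apply/root_int/isroot_act.
Qed.

(** The standard scalar product averaged over W: invariant and positive definite by construction. It
    stands in for the definiteness of B, which its matrix does not show directly. *)
Definition avg_form (x y : V) : R := \sum_(g : gT) \sum_i (act g x) 0 i * (act g y) 0 i.

Lemma avg_formC x y : avg_form x y = avg_form y x.
Proof. by apply: eq_bigr => g _; apply: eq_bigr => i _; rewrite mulrC. Qed.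

Lemma avg_formDl x y z : avg_form (x + y) z = avg_form x z + avg_form y z.
Proof.
rewrite -big_split; apply: eq_bigr => g _; rewrite -big_split; apply: eq_bigr => i _ /=.
by rewrite geom_actD // mxE mulrDl.
Qed.

Lemma avg_formZl c x z : avg_form (c *: x) z = c * avg_form x z.
Proof.
rewrite /avg_form mulr_sumr; apply: eq_bigr => g _; rewrite mulr_sumr; apply: eq_bigr => i _ /=.
by rewrite geom_actZ // mxE mulrA.
Qed.

Lemma avg_formNl x z : avg_form (- x) z = - avg_form x z.
Proof. by rewrite -scaleN1r avg_formZl mulN1r. Qed.

Lemma avg_form_act h x y : avg_form (act h x) (act h y) = avg_form x y.
Proof.
rewrite /avg_form [RHS](reindex_inj (mulIg h)); apply: eq_bigr => g _.
by apply: eq_bigr => i _ /=; rewrite !geom_actM.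
Qed.

Lemma avg_form_gt0 x : x != 0 -> 0 < avg_form x x.
Proof.
move=> hx; have hge g : 0 <= \sum_i (act g x) 0 i * (act g x) 0 i.
  by apply: sumr_ge0 => i _; rewrite -expr2 sqr_ge0.
rewrite lt_def sumr_ge0 ?andbT //; apply: contra hx => /eqP h0.
have h1 : \sum_i act 1%g x 0 i * act 1%g x 0 i = 0.
  exact: (psumr_eq0P (fun g _ => hge g) h0).
rewrite geom_act1 // in h1.
apply/eqP/rowP => i; rewrite mxE; apply/eqP.
have h2 j (_ : true) : 0 <= x 0 j * x 0 j by rewrite -expr2 sqr_ge0.
suff : x 0 i * x 0 i == 0 by rewrite mulf_eq0 orbb.
by apply/eqP; exact: (psumr_eq0P h2 h1).
Qed.

(** Invariance under r_a, which negates a, determines the averaged product with a up to the scale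
    factor of a. *)
Lemma avg_form_refl x a : isroot a -> avg_form x a = B x a * avg_form a a.
Proof.
move=> ha; have := avg_form_act (rr a) x a; rewrite !geom_act_rr // refl_self ?root_norm //.
rewrite avg_formC avg_formNl avg_formC !reflE avg_formDl avg_formNl avg_formZl; lra.
Qed.

Lemma bform_root_lt1 x a : isroot x -> isroot a -> x <> a -> B x a < 1.
Proof.
move=> hx ha hne; have := avg_form_gt0 (root_neq0 hW hx); have := avg_form_gt0 (root_neq0 hW ha).
have hxa : x - a != 0 by rewrite subr_eq0; apply/eqP.
have := avg_form_gt0 hxa.
have h1 := avg_form_refl x ha; have h2 := avg_form_refl a hx.
rewrite avg_formDl avg_formNl avg_formC avg_formDl avg_formNl (avg_formC _ (x - a)) avg_formDl avg_formNl.
rewrite h2 h1 (bformC hW a x); rewrite avg_formC h1 (bformC hW a x) in h2.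
set b := B x a in h1 h2 *; set A := avg_form a a in h1 h2 *; set X := avg_form x x in h1 h2 *.
move=> h hA hX.
have [hb|hb] := eqVneq b 0; first by rewrite hb ltr01.
(* The averaged product of x and a is both bA and bX. With A = X, the averaged square of x - a is
   2(1 - b)A, and it is positive. *)
have hAX : A = X by apply: (mulfI hb).
rewrite -hAX in h; have h' : 0 < 2 * (1 - b) * A by move: h; congr (0 < _); ring.
by move: h'; rewrite pmulr_lgt0 // => h'; lra.
Qed.

Lemma bform_root_cases x a : isroot x -> isroot a -> x <> a -> x <> - a ->
  [\/ B x a = 0, B x a = 2^-1 | B x a = - 2^-1].
Proof.
move=> hx ha h1 h2; have l1 := bform_root_lt1 hx ha h1.
have ha' : isroot (- a) by rewrite isrootNE.
have := bform_root_lt1 hx ha' h2; rewrite bformNr // => l2.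
have /intrP[m hm] := bform_root_int hx ha.
have hm1 : (m < 2)%R by rewrite -(ltr_int R) -hm /=; lra.
have hm2 : (-2 < m)%R by rewrite -(ltr_int R) -hm /=; lra.
have [e|[e|e]] : m = 0 \/ m = 1 \/ m = -1 by lia.
- by constructor 1; rewrite e in hm; lra.
- by constructor 2; rewrite e in hm; lra.
- by constructor 3; rewrite e in hm; lra.
Qed.

Lemma refl_obtuse b d : B d b = - 2^-1 -> refl b d = d + b.
Proof. by move=> h; rewrite !reflE h mulrN mulfV ?pnatr_eq0 // scaleN1r opprK. Qed.

Lemma posr_add_obtuse b d : posr b -> posr d -> B d b = - 2^-1 -> posr (d + b).
Proof.
move=> hb hd h; rewrite posr_nnegE nnegD; [|by case/andP: hd|by case/andP: hb].
by rewrite -(refl_obtuse h) isroot_refl // posr_root.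
Qed.

(* Applying both sides to a and c shows that a lies in the plane of d and b. *)
Lemma rotation_factorizations a c d b :
  posr a -> posr c -> posr d -> posr b -> B d b = - 2^-1 ->
  (rr a * rr c = rr d * rr b)%g ->
  [\/ a = d /\ c = b, a = b /\ c = d + b | a = d + b /\ c = d].
Proof.
move=> ha hc hd hb hB e.
have [ha' hc' hd' hb'] := And4 (posr_root ha) (posr_root hc) (posr_root hd) (posr_root hb).
have hk := posr_add_obtuse hb hd hB; have hk' := posr_root hk.
have ecan t : a = t -> (rr c = rr t * rr d * rr b)%g.
  by move=> <-; rewrite -mulgA -e mulgA rr2 // mul1g.
have [ead|nad] := eqVneq a d.
  constructor 1; split=> //; apply: (rr_inj hW hc hb).
  by rewrite (ecan _ ead) rr2 // mul1g.
have [eab|nab] := eqVneq a b.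
  constructor 2; split=> //; apply: (rr_inj hW hc hk).
  by rewrite (ecan _ eab) -(refl_obtuse hB) -geom_act_rr // rr_act // rrV.
have hB' : B b d = - 2^-1 by rewrite bformC.
have [eak|nak] := eqVneq a (d + b).
  constructor 3; split=> //; apply: (rr_inj hW hc hd).
  rewrite (ecan _ eak) addrC -(refl_obtuse hB') -geom_act_rr // rr_act // rrV //.
  by rewrite -!mulgA (mulgA (rr d) (rr d)) rr2 // mul1g rr2 // mulg1.
exfalso.
have nac : a <> c.
  move=> eac; move: e; rewrite eac rr2 // => /esym/eqP; rewrite -eq_invg_mul rrV // => /eqP h.
  by have := root_norm hW hb'; rewrite -{1}(rr_inj hW hd hb h) hB; lra.
have nneg' t : posr t -> a <> - t by move=> ht h; have := posr_opp hW ht; rewrite -h ha.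
have hE x : refl a (refl c x) = refl d (refl b x).
  by rewrite -!geom_act_rr // -!geom_actM // e.
have hspan : exists p q, a = p *: d + q *: b.
  have := hE a; have := hE c; rewrite !reflE !bformL // !root_norm // (bformC hW b d) hB.
  rewrite (bformC hW c a).
  set u1 := B a b; set u2 := B a d; set u3 := B c b; set u4 := B c d; set w := B a c.
  have hw : w ^+ 2 - 1 != 0.
    by rewrite /w; have [->|->|->] := bform_root_cases ha' hc' nac (nneg' _ hc); apply/eqP; lra.
  move=> h1 h2.
  (* The equation at a minus w times the equation at c eliminates c and expresses 2(w^2 - 1)a
     through d and b. *)
  exists ((- (u2 + u1) + w * (u4 + u3)) / (w ^+ 2 - 1)), ((- u1 + w * u3) / (w ^+ 2 - 1)).
  apply/rowP => k; move/rowP/(_ k): h1; move/rowP/(_ k): h2; rewrite !mxE => h2 h1.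
  have h3 := congr1 ( *%R w) h1.
  rewrite !(mulrAC _ (w ^+ 2 - 1)^-1) -mulrDl; apply: (canRL (mulfK hw)).
  move: h2 h3; set ak := a _ _; set ck := c _ _; set dk := d _ _; set bk := b _ _.
lra.
have [p [q hpq]] := hspan.
have had : B a d = p - q / 2.
  by rewrite hpq !bformL // root_norm // (bformC hW b d) hB; lra.
have hab : B a b = q - p / 2.
  by rewrite hpq !bformL // root_norm // hB; lra.
have hn : p ^+ 2 + q ^+ 2 - p * q = 1.
  have <- := root_norm hW ha'; rewrite hpq !bformL // !root_norm // (bformC hW b d) hB.
  by field.
(* This inverts the Gram matrix of d and b. Of the nine possible values of (B a d, B a b), the norm
   condition keeps two, for which a is d + b or its opposite. *)
have hp : p = 2 / 3 * (2 * B a d + B a b) by lra.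
have hq : q = 2 / 3 * (2 * B a b + B a d) by lra.
have hzero : B a d = 2^-1 /\ B a b = 2^-1 \/ B a d = - 2^-1 /\ B a b = - 2^-1.
  move: hn; rewrite hp hq.
  have [->|->|->] := bform_root_cases ha' hd' (elimN eqP nad) (nneg' _ hd);
  have [->|->|->] := bform_root_cases ha' hb' (elimN eqP nab) (nneg' _ hb) => h;
    (by left) || (by right) || (exfalso; lra).
case: hzero => -[h1 h2].
  have p1 : p = 1 by lra. have q1 : q = 1 by lra.
  by case/eqP: nak; rewrite hpq p1 q1 !scale1r.
have p1 : p = -1 by lra. have q1 : q = -1 by lra.
by case: (nneg' _ hk); rewrite {1}hpq p1 q1 !scaleN1r opprD.
Qed.

End RankTwo.

(** * The Bruhat order *)

Section BruhatOrder.
Variables (gT : finGroupType) (n : nat) (s : 'I_n -> gT).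
Hypothesis hW : simply_laced_weyl_group s.
Variable R : realType.

Local Notation "''a_' i" := (@simple_root R n i) (at level 8, i at level 2, format "''a_' i").
Local Notation act := (@geom_act R gT n s).
Local Notation refl := (@refl R gT n s).
Local Notation posr := (@is_posroot R gT n s).
Local Notation rr := (@root_refl R gT n s).

Let gen := coxeter_gen hW.
Let s2 := coxeter_invol hW.

(** A reflection on the right of v becomes one on the left by conjugation with v, and its root may
    be taken positive. The left form is the one that [len_rr] describes. *)
Lemma bruhat_stepP (v w : gT) :
  reflect (exists2 c, posr c & w = (rr c * v)%g /\ (len s v < len s w)%N) (bruhat_step s v w).
Proof.
apply: (iffP andP) => [[/existsP[u /existsP[i /eqP hw]] hlt]|[c hc [hw hlt]]].
  have hr := isroot_act hW (v * u) (isroot_simple R hW i).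
  have hw' : w = (rr (act (v * u)%g 'a_i) * v)%g.
    by rewrite rr_act ?isroot_simple // rr_simple // hw invMg !mulgA mulgKV.
  have [hp|hp] := root_cases hW hr; first by exists (act (v * u)%g 'a_i).
  by exists (- act (v * u)%g 'a_i) => //; rewrite rrN.
split=> //; case/(posr_root)/isrootP: (hc) => g [i hg].
apply/existsP; exists (v^-1 * g)%g; apply/existsP; exists i.
by rewrite hw hg rr_act ?isroot_simple // rr_simple // invMg invgK !mulgA mulgV mul1g.
Qed.

(** Conjugation by s_i keeps the root c positive, and with it the direction of the step, unless c is
    ['a_i]; in that case the step is the multiplication by s_i itself. *)
Lemma bruhat_step_mull i (v w : gT) : bruhat_step s v w ->
  (s i * v)%g = w \/ bruhat_step s (s i * v) (s i * w).
Proof.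
case/bruhat_stepP => c hc [hw hlt].
have hpos : posr (act v^-1 c) by rewrite (len_rr hW) // -hw.
have [hci|hci] := eqVneq c 'a_i; first by left; rewrite hw hci rr_simple.
right; have hc' := posr_refl_simple hW hc (elimN eqP hci).
have e : (s i * w = rr (refl 'a_i c) * (s i * v))%g.
  rewrite -(geom_act_s hW) rr_act ?posr_root // hw (invs s2).
  by rewrite !mulgA (mulKs s2).
apply/bruhat_stepP; exists (refl 'a_i c) => //; split=> //.
rewrite e -(len_rr hW) // invMg (invs s2) geom_actM // (geom_act_s hW).
by rewrite reflK ?bform_aa.
Qed.

Lemma bruhat_ind (P : gT -> gT -> Prop) :
  (forall w, P w w) ->
  (forall v x w, bruhat_step s v x -> bruhat s x w -> P x w -> P v w) ->
  forall v w, bruhat s v w -> P v w.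
Proof.
move=> P1 P2 v w /connectP[p]; elim: p v => [|x p IHp] v /=; first by move=> _ ->.
case/andP => hvx hp hw; apply: P2 hvx _ (IHp _ hp hw).
by apply/connectP; exists p.
Qed.

(** A lifting property without length hypotheses: s_i is pushed along a chain of steps until,
    possibly, it meets a step equal to it. *)
Lemma bruhat_mull i (v w : gT) : bruhat s v w -> bruhat s (s i * v) w \/ bruhat s (s i * v) (s i * w).
Proof.
move: v w; apply: bruhat_ind => [w|v x w hvx hxw IH]; first by right; apply: connect0.
have [->|h] := bruhat_step_mull i hvx; first by left.
by case: IH => IH; [left|right]; apply: connect_trans IH; apply: connect1.
Qed.

Lemma bruhat_mull_top i (v w : gT) : bruhat s v w -> bruhat s v (s i * w) \/ bruhat s (s i * v) (s i * w).
Proof.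
move: v w; apply: bruhat_ind => [w|v x w hvx hxw IH]; first by right; apply: connect0.
case: IH => IH; first by left; apply: connect_trans IH; apply: connect1.
have [h|h] := bruhat_step_mull i hvx; last first.
  by right; apply: connect_trans IH; apply: connect1.
by left; move: IH; rewrite -h (mulsK s2).
Qed.

Lemma bruhat_len (v w : gT) : bruhat s v w -> v = w \/ (len s v < len s w)%N.
Proof.
move: v w; apply: bruhat_ind => [w|v x w /andP[_ hvx] hxw IH]; first by left.
by right; case: IH => [<- //|]; apply: ltn_trans.
Qed.

Lemma bruhatV (v w : gT) : bruhat s v w -> bruhat s v^-1 w^-1.
Proof.
move: v w; apply: bruhat_ind => [w|v x w hvx hxw IH]; first exact: connect0.
apply: connect_trans IH; apply: connect1; move: hvx => /andP[/existsP[u /existsP[i /eqP hx]] hlt].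
rewrite /bruhat_step !lenV // hlt andbT; apply/existsP; exists (v * u)%g; apply/existsP; exists i.
by rewrite hx !invMg invgK (invs s2) !mulgA mulVg mul1g.
Qed.

Lemma bruhat_smul (w : gT) i : (len s w < len s (s i * w))%N -> bruhat s w (s i * w).
Proof.
move=> h; apply: connect1; apply/bruhat_stepP; exists 'a_i; first exact: posr_simple.
by rewrite rr_simple.
Qed.

Lemma len_mull_cases i (g : gT) : len s (s i * g) = (len s g).+1 \/ len s g = (len s (s i * g)).+1.
Proof.
have := @len_mulr_cases gT n s hW g^-1 i.
have -> : (g^-1 * s i = (s i * g)^-1)%g by rewrite invMg (invs s2).
by rewrite !lenV.
Qed.

Lemma posr_actV_simple i (g : gT) : posr (act g^-1 'a_i) = (len s g < len s (s i * g))%N.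
Proof. by rewrite (len_rr hW) ?posr_simple // rr_simple. Qed.

End BruhatOrder.

(** * The pairing of monomials *)

Section Pairing.
Variables (R : realType) (gT : finGroupType) (n : nat) (s : 'I_n -> gT).
Hypothesis hW : simply_laced_weyl_group s.

Local Notation V := 'rV[R]_n.
Local Notation C := R[i].
Local Notation B := (@bform R gT n s).
Local Notation act := (@geom_act R gT n s).
Local Notation refl := (@refl R gT n s).
Local Notation isroot := (@is_root R gT n s).
Local Notation posr := (@is_posroot R gT n s).
Local Notation rr := (@root_refl R gT n s).

(* The summands x_b (x) k' of the component of degree (1, m-1) of the
   coproduct of the monomial k: each letter in turn is moved to the front. *)
Fixpoint ext (k : seq V) : seq (V * seq V) :=
  if k is a :: k' then (a, k') :: [seq (refl a p.1, a :: p.2) | p <- ext k']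
  else [::].

(** The coefficient of x_c in x_b under x_(-a) = - x_a, so that reflected letters need not be made
    positive. *)
Definition rcoef (c b : V) : C := (b == c)%:R - (b == - c)%:R.

(* The coefficient of the monomial g in the braided factorial of k. *)
Fixpoint pairing (g k : seq V) : C :=
  if g is c :: g' then \sum_(p <- ext k) rcoef c p.1 * pairing g' p.2
  else (k == [::])%:R.

Lemma ext_size k p : p \in ext k -> (size p.2).+1 = size k.
Proof.
elim: k p => [|a k IHk] p //=; rewrite inE => /orP[/eqP -> //|/mapP[q hq ->]] /=.
by rewrite (IHk q).
Qed.

Lemma ext_roots k p : all isroot k -> p \in ext k -> isroot p.1 && all isroot p.2.
Proof.
elim: k p => [|a k IHk] p //= /andP[ha hk].
rewrite inE => /orP[/eqP -> /=|/mapP[q hq ->] /=]; first by rewrite ha hk.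
by case/andP: (IHk q hk hq) => h1 h2; rewrite ha h2 isroot_refl.
Qed.

Lemma ext_cat k1 k2 : ext (k1 ++ k2) =
  [seq (p.1, p.2 ++ k2) | p <- ext k1] ++ [seq (foldr refl p.1 k1, k1 ++ p.2) | p <- ext k2].
Proof.
elim: k1 => [|a k1 IHk] /=.
  by elim: (ext k2) => //= -[x l] q {1}->.
by rewrite IHk map_cat -!map_comp.
Qed.

Lemma rcoefNr c b : rcoef c (- b) = - rcoef c b.
Proof. by rewrite /rcoef eqr_opp -eqr_oppLR opprB. Qed.

Lemma rcoefNl c b : rcoef (- c) b = - rcoef c b.
Proof. by rewrite /rcoef opprK opprB. Qed.

Lemma rcoef_act g c b : rcoef (act g c) (act g b) = rcoef c b.
Proof.
have hinj x y : (act g x == act g y) = (x == y).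
  by apply/eqP/eqP => [h|-> //]; rewrite -(geom_actVK hW g x) h geom_actVK.
by rewrite /rcoef -geom_actN // !hinj.
Qed.

Lemma rcoef_refl a c b : isroot a -> rcoef c (refl a b) = rcoef (refl a c) b.
Proof.
by move=> ha; rewrite -[RHS](rcoef_act (rr a)) !geom_act_rr // reflK // root_norm.
Qed.

Lemma rcoef_neq0 c b : isroot c -> rcoef c b != 0 -> isroot b /\ rr b = rr c.
Proof.
move=> hc; rewrite /rcoef; have [->//|_] := eqVneq b c.
by have [->|_] := eqVneq b (- c); rewrite ?subrr ?eqxx // isrootNE // rrN.
Qed.

Lemma rcoef_posr c b : posr c -> posr b -> rcoef c b = (b == c)%:R.
Proof.
move=> hc hb; rewrite /rcoef; have [e|_] := eqVneq b (- c); last by rewrite subr0.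
by have := posr_opp hW hc; rewrite -e hb.
Qed.

Lemma foldr_reflN x k : foldr refl (- x) k = - foldr refl x k.
Proof. by elim: k => //= a k ->; rewrite reflN. Qed.

Lemma pairing_size g k : size g != size k -> pairing g k = 0.
Proof.
elim: g k => [|c g IHg] k /=; first by rewrite eq_sym size_eq0 => /negPf ->.
move=> h; rewrite big_seq big1 // => p hp; rewrite IHg ?mulr0 //.
by move: h; rewrite -(ext_size hp) eqSS.
Qed.

Lemma ext_act u k : ext (map (act u) k) = [seq (act u p.1, map (act u) p.2) | p <- ext k].
Proof.
elim: k => //= a k ->; rewrite -!map_comp; congr (_ :: _).
by apply: eq_map => p /=; rewrite geom_act_refl.
Qed.

Lemma pairing_act u g k : pairing (map (act u) g) (map (act u) k) = pairing g k.
Proof.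
elim: g k => [|c g IHg] k /=; first by case: k.
by rewrite ext_act big_map; apply: eq_bigr => p _; rewrite rcoef_act IHg.
Qed.

Lemma pairing_sign g k1 a k2 : pairing g (k1 ++ - a :: k2) = - pairing g (k1 ++ a :: k2).
Proof.
elim: g k1 k2 => [|c g IHg] k1 k2 /=; first by case: k1 => [|? ?]; rewrite oppr0.
rewrite !ext_cat !big_cat /= !big_map opprD -sumrN; congr (_ + _).
  by apply: eq_bigr => p _ /=; rewrite IHg mulrN.
rewrite !big_cons /= !big_map opprD foldr_reflN rcoefNr mulNr -sumrN; congr (_ + _).
by apply: eq_bigr => p _ /=; rewrite IHg reflNl // mulrN.
Qed.

Lemma pairing2 c d a b :
  pairing [:: c; d] [:: a; b] = rcoef c a * rcoef d b + rcoef c (refl a b) * rcoef d a.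
Proof. by rewrite /= !big_cons !big_nil /= !mulr1 !addr0. Qed.

(** The second letter crosses the first and becomes -a, so the two extractions cancel. *)
Lemma pairing_square g a : isroot a -> pairing g [:: a; a] = 0.
Proof.
move=> ha; case: (altP (size g =P 2)) => [|h]; last by rewrite pairing_size.
case: g => [|c [|d []]] // _; rewrite pairing2 refl_self ?root_norm // rcoefNr.
by rewrite mulNr subrr.
Qed.

(** Each monomial contributes two terms, and they match because r_a b = b + a, r_b(b + a) = a and
    r_(b+a) a = -b. *)
Lemma pairing_triangle g a b : isroot a -> isroot b -> B b a = - 2^-1 ->
  pairing g [:: a; b] = pairing g [:: b; b + a] + pairing g [:: b + a; a].
Proof.
move=> ha hb h; case: (altP (size g =P 2)) => [|hs]; last by rewrite !pairing_size ?addr0.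
have h' : B a b = - 2^-1 by rewrite bformC.
have e1 : refl a b = b + a by rewrite refl_obtuse.
have e2 : refl b (b + a) = a by rewrite reflD refl_self ?root_norm // refl_obtuse // addrC addrK.
have e3 : refl (b + a) a = - b.
  by rewrite !reflE bformDr // root_norm // h'; apply/rowP => k; rewrite !mxE; by field.
case: g => [|c [|d []]] // _; rewrite !pairing2 e1 e2 e3 rcoefNr; ring.
Qed.

(** A monomial in two distinct positive roots pairs with itself to 1. Testing with both monomials
    leaves only equal letters, possibly in the other order. *)
Lemma pairing_distinct a c b d : posr a -> posr c -> posr b -> posr d -> a <> c -> b <> d ->
  (forall g, all isroot g -> pairing g [:: a; c] = pairing g [:: b; d]) ->
  a = b /\ c = d \/ a = d /\ c = b.
Proof.
move=> ha hc hb hd hac hbd h.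
have key x y : posr x -> posr y -> x <> y -> pairing [:: x; y] [:: x; y] = 1.
  move=> hx hy hxy; rewrite pairing2 (@rcoef_posr x x) // (@rcoef_posr y y) // (@rcoef_posr y x) //.
  by rewrite !eqxx (introF eqP hxy) mulr0 addr0 mulr1.
have h1 : 1 = rcoef a b * rcoef c d + rcoef a (refl b d) * rcoef c b.
  by rewrite -pairing2 -h ?key //= !posr_root.
have h2 : rcoef b a * rcoef d c + rcoef b (refl a c) * rcoef d a = 1.
  by rewrite -pairing2 h ?key //= !posr_root.
move: h1 h2; rewrite (@rcoef_posr a b) // (@rcoef_posr c b) // (@rcoef_posr c d) //.
rewrite (@rcoef_posr b a) // (@rcoef_posr d c) // (@rcoef_posr d a) //.
have [eba|nba] := eqVneq b a.
  have [edc|ndc] := eqVneq d c; first by left.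
  by rewrite eba (introF eqP hac) !mulr0 addr0 => /eqP; rewrite oner_eq0.
have [ebc|nbc] := eqVneq b c; last first.
  by rewrite mul0r mulr0 add0r => /eqP; rewrite oner_eq0.
have [ead|nad] := eqVneq a d; first by right.
by move=> _; rewrite mul0r mulr0 addr0 => /eqP; rewrite eq_sym oner_eq0.
Qed.

(** The adjoint of word reversal for the pairing: each letter is reflected by all letters after it,
    the nearest one first. It yields the stability of the ideal under [rho]. *)
Fixpoint rev_pair (g : seq V) : seq V :=
  if g is c :: g' then foldr refl c (rev g') :: rev_pair g' else [::].

Lemma foldr_reflK k x : all isroot k -> foldr refl (foldr refl x (rev k)) k = x.
Proof.
elim: k x => //= a k IHk x /andP[ha hk].
by rewrite rev_cons -cats1 foldr_cat /= IHk // reflK // root_norm.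
Qed.

Lemma foldr_reflKV k x : all isroot k -> foldr refl (foldr refl x k) (rev k) = x.
Proof. by move=> hk; rewrite -{1}(revK k) foldr_reflK // all_rev. Qed.

Lemma foldr_refl_root k x : all isroot k -> isroot x -> isroot (foldr refl x k).
Proof. by elim: k => //= a k IHk /andP[ha hk] hx; rewrite isroot_refl // IHk. Qed.

Lemma foldr_refl_refl k x y : all isroot k ->
  refl (foldr refl x k) (foldr refl y k) = foldr refl (refl x y) k.
Proof.
elim: k => //= a k IHk /andP[ha hk].
by rewrite refl_refl ?root_norm // IHk.
Qed.

Lemma rcoef_foldr_refl k c b : all isroot k ->
  rcoef (foldr refl c k) (foldr refl b k) = rcoef c b.
Proof.
elim: k => //= a k IHk /andP[ha hk].
by rewrite rcoef_refl // reflK ?root_norm // IHk.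
Qed.

Lemma ext_index k : ext k =
  [seq (foldr refl (nth 0 k i) (take i k), take i k ++ drop i.+1 k) | i <- index_iota 0 (size k)].
Proof.
rewrite /index_iota subn0; elim: k => //= a k ->; rewrite drop0; congr (_ :: _).
by rewrite -map_comp (iotaDl 1) -map_comp; apply: eq_map.
Qed.

Lemma ext_refl k p : all isroot k -> p \in ext k ->
  forall x, foldr refl x k = refl p.1 (foldr refl x p.2).
Proof.
elim: k p => [|a k IHk] p //= /andP[ha hk].
rewrite inE => /orP[/eqP -> //|/mapP[q hq ->] x /=].
by rewrite refl_refl ?root_norm // -(IHk q).
Qed.

(* The operators compared here are the actions of the W-degrees of g and k. *)
Lemma pairing_degree g k : all isroot g -> all isroot k -> pairing g k != 0 ->
  forall x, foldr refl x g = foldr refl x k.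
Proof.
elim: g k => [|c g IHg] k /=; first by case: k => //= ? ? _ _; rewrite eqxx.
case/andP=> hc hg hk hne x.
have [p hp] : exists2 p, p \in ext k & rcoef c p.1 * pairing g p.2 != 0.
  apply: contrapT => hn; case/eqP: hne; rewrite big_seq big1 // => p hp.
  by apply/eqP/negPn/negP => h; apply: hn; exists p.
rewrite mulf_eq0 negb_or => /andP[h1 h2].
have /andP[hp1 hp2] := ext_roots hk hp.
rewrite (ext_refl hk hp) -(IHg _ hg hp2 h2).
have [_ e] := rcoef_neq0 hc h1.
by rewrite -!geom_act_rr // e.
Qed.

Lemma rev_pair_roots g : all isroot g -> all isroot (rev_pair g).
Proof.
elim: g => //= c g IHg /andP[hc hg]; rewrite IHg // andbT.
by rewrite foldr_refl_root // all_rev.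
Qed.

Lemma foldr_rev_pair g x : all isroot g ->
  foldr refl x (rev_pair g) = foldr refl x (rev g).
Proof.
elim: g => //= c g IHg /andP[hc hg]; rewrite IHg //.
by rewrite rev_cons -cats1 foldr_cat /= foldr_refl_refl // all_rev.
Qed.

(** In the reversed word the extracted letter crosses the letters that follow it in k rather than
    those that precede it. Where the rest pairs nontrivially, equality of W-degrees converts one
    crossing into the other. *)
Lemma pairing_rev g k : all isroot g -> all isroot k ->
  pairing g (rev k) = pairing (rev_pair g) k.
Proof.
elim: g k => [|c g IHg] k /=; first by rewrite -!size_eq0 size_rev.
case/andP=> hc hg hk.
rewrite !ext_index size_rev !big_map.
rewrite big_nat_rev [LHS]big_seq_cond [RHS]big_seq_cond; apply: eq_bigr => i.
rewrite andbT mem_index_iota add0n /= => hi.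
set m := size k in hi *; set a := nth 0 k i.
have hk1 : all isroot (take i k) by apply/allP => x /mem_take; exact: (allP hk).
have hk2 : all isroot (drop i.+1 k) by apply/allP => x /mem_drop; exact: (allP hk).
have -> : nth 0 (rev k) (m - i.+1) = a.
  by rewrite nth_rev -/m; [congr (nth 0 k _); lia|lia].
have -> : take (m - i.+1) (rev k) = rev (drop i.+1 k).
  by rewrite take_rev -/m; congr (rev (drop _ k)); lia.
have -> : drop (m - i.+1).+1 (rev k) = rev (take i k).
  by rewrite drop_rev -/m; congr (rev (take _ k)); lia.
rewrite -rev_cat IHg ?all_cat ?hk1 //.
have [->|hne] := eqVneq (pairing (rev_pair g) (take i k ++ drop i.+1 k)) 0.
  by rewrite !mulr0.
congr (_ * _).
have hdeg := pairing_degree (rev_pair_roots hg) _ hne.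
rewrite -(foldr_rev_pair c hg) hdeg ?all_cat ?hk1 // foldr_cat rcoef_foldr_refl //.
by rewrite -[RHS](rcoef_foldr_refl _ _ (k := rev (drop i.+1 k))) ?all_rev // foldr_reflKV.
Qed.

End Pairing.

(** * Products of simple root vectors *)

Section SimpleWords.
Variables (R : realType) (gT : finGroupType) (n : nat) (s : 'I_n -> gT).
Hypothesis hW : simply_laced_weyl_group s.

Local Notation V := 'rV[R]_n.
Local Notation C := R[i].
Local Notation "''a_' i" := (@simple_root R n i) (at level 8, i at level 2, format "''a_' i").
Local Notation act := (@geom_act R gT n s).
Local Notation refl := (@refl R gT n s).
Local Notation isroot := (@is_root R gT n s).
Local Notation posr := (@is_posroot R gT n s).
Local Notation rr := (@root_refl R gT n s).
Local Notation ext := (@ext R gT n s).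
Local Notation pairing := (@pairing R gT n s).

Let gen := coxeter_gen hW.
Let s2 := coxeter_invol hW.

Definition simple_word (e : seq 'I_n) : seq V := map (@simple_root R n) e.

Lemma simple_word_roots e : all isroot (simple_word e).
Proof. by elim: e => //= i e ->; rewrite isroot_simple. Qed.

Lemma ext_simple e p : p \in ext (simple_word e) ->
  isroot p.1 /\ exists f, [/\ p.2 = simple_word f, (size f).+1 = size e
                            & word_prod s f = (rr p.1 * word_prod s e)%g].
Proof.
elim: e p => [|i e IHe] p //=; rewrite inE => /orP[/eqP ->|/mapP[q hq ->]] /=.
  split; first exact: isroot_simple.
  by exists e; rewrite rr_simple // word_prod_cons mulsK.
have [h1 [f [h2 h3 h4]]] := IHe q hq; split.
  by rewrite isroot_refl // isroot_simple.
exists (i :: f); rewrite /= h2 h3 !word_prod_cons h4; split=> //.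
by rewrite -(geom_act_s hW) rr_act // (invs s2) !mulgA (mulKs s2).
Qed.

(* Counts with signs the changes of sign of c along the word e. *)
Lemma sum_rcoef_simple e c : isroot c ->
  \sum_(p <- ext (simple_word e)) rcoef c p.1 =
  (posr c)%:R - (posr (act (word_prod s e)^-1 c))%:R.
Proof.
elim: e c => [|i e IHe] c hc /=.
  by rewrite big_nil word_prod0 invg1 geom_act1 // subrr.
rewrite big_cons big_map /=.
under eq_bigr => p _ do rewrite rcoef_refl ?isroot_simple //.
rewrite IHe ?isroot_refl ?isroot_simple // word_prod_cons invMg (invs s2).
rewrite geom_actM // geom_act_s // addrA; congr (_ - _).
have hself : refl 'a_i 'a_i = - 'a_i by rewrite refl_self ?bform_aa.
have hpi := posr_simple R hW i.
rewrite /rcoef; have [<-|h1] := eqVneq 'a_i c.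
  rewrite hself (negPf (posr_opp hW hpi)) hpi addr0.
  have [e0|_] := eqVneq 'a_i (- 'a_i); last by rewrite subr0.
  by have := posr_opp hW hpi; rewrite -e0 hpi.
have [h2|h2] := eqVneq 'a_i (- c).
  have -> : c = - 'a_i by rewrite h2 opprK.
  by rewrite reflN hself opprK hpi (negPf (posr_opp hW hpi)) sub0r addNr.
rewrite subr0 add0r; congr (_%:R); congr nat_of_bool.
have [hp|hp] := boolP (posr c).
  by rewrite posr_refl_simple // => e0; rewrite e0 eqxx in h1.
have hn := npos_neg hW hc hp; apply/negbTE.
rewrite -(posr_oppE hW) ?isroot_refl ?isroot_simple // -reflN.
by apply: posr_refl_simple => // e0; rewrite e0 eqxx in h2.
Qed.

(* The pairing of g with a product of simple root vectors depends only on the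
   value of the word: each step replaces w by the reflected element r_c w. *)
Fixpoint wpair (g : seq V) (w : gT) : C :=
  if g is c :: g' then
    ((posr c)%:R - (posr (act w^-1 c))%:R) * wpair g' (rr c * w)
  else (w == 1%g)%:R.

(** All extractions that contribute for c leave a word for the same element r_c w. The induction
    hypothesis is thus a common factor, and the signed count of these extractions is
    [sum_rcoef_simple]. *)
Lemma pairing_simple_word g e : all isroot g ->
  pairing g (simple_word e) = (size g == size e)%:R * wpair g (word_prod s e).
Proof.
elim: g e => [|c g IHg] e.
  move=> _ /=; case: e => [|i e] /=; last by rewrite mul0r.
  by rewrite word_prod0 eqxx mulr1.
move=> /= /andP[hc hg].
transitivity (\sum_(p <- ext (simple_word e))
   rcoef c p.1 * ((size (c :: g) == size e)%:R * wpair g (rr c * word_prod s e))).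
  rewrite [LHS]big_seq [RHS]big_seq; apply: eq_bigr => p hp.
  have [->|hne] := eqVneq (rcoef c p.1) 0; first by rewrite !mul0r.
  have [_ hrr] := rcoef_neq0 hW hc hne.
  have [hp1 [f [h2 h3 h4]]] := ext_simple hp.
  by rewrite h2 IHg // h4 hrr -h3 /= eqSS.
by rewrite -mulr_suml sum_rcoef_simple // mulrCA.
Qed.

(** A nonzero factor means that the inverse of w changes the sign of c, so r_c w is shorter than w.
    Products along nonreduced words vanish for this reason. *)
Lemma wpair_len g w : all isroot g -> wpair g w != 0 -> (size g <= len s w)%N.
Proof.
elim: g w => //= c g IHg w /andP[hc hg]; rewrite mulf_eq0 negb_or => /andP[h1 h2].
apply: leq_ltn_trans (IHg _ hg h2) _.
have hact d : isroot d -> isroot (act w^-1 d) by move=> hd; exact: isroot_act.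
have [hp|hn] := boolP (posr c).
  apply: len_rr_lt => //; apply: npos_neg => //; first exact: hact.
  by apply: contra h1 => h; rewrite hp h subrr.
rewrite -rrN //; apply: len_rr_lt => //; first exact: npos_neg.
rewrite geom_actN // opprK; apply: contraNT h1 => /negPf ->.
by rewrite (negPf hn) subrr.
Qed.

(** These functionals are dual to the x_w; this is the form in which linear independence is used. *)
Lemma wpair_dual e w : reduced s e -> wpair (simple_word e) w = (w == word_prod s e)%:R.
Proof.
elim: e w => [|i e IHe] w hred /=; first by rewrite word_prod0.
rewrite IHe; last exact: reduced_behead hred.
rewrite rr_simple // posr_simple // word_prod_cons.
have -> : (s i * w == word_prod s e)%g = (w == s i * word_prod s e)%g.
  by apply/eqP/eqP => [<-|->]; rewrite mulsK.
have [->|_] := eqVneq w (s i * word_prod s e)%g; last by rewrite mulr0.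
rewrite mulr1 posr_actV_simple // (mulsK s2) -word_prod_cons.
rewrite -(reduced_size gen hred) -(reduced_size gen (reduced_behead hred)) /=.
by rewrite ltnNge leqnSn subr0.
Qed.

End SimpleWords.

(** * The braided factorial *)

Section AdjacentTranspositions.
Variable m : nat.
Local Notation adj := (@adj_transp m).
Local Open Scope group_scope.

Lemma adjE i (x : 'I_m.+1) : val (adj i x) =
  (if x == i :> nat then i.+1 else if x == i.+1 :> nat then (i : nat) else x).
Proof.
rewrite /adj_transp; have [->|->|/eqP h1 /eqP h2] := tpermP.
- by rewrite /= eqxx /bump.
- by rewrite /= /bump add1n eqxx; case: eqP => //; lia.
move: h1 h2; rewrite -!val_eqE /= /bump add1n => /negPf -> /negPf -> //.
Qed.

Lemma adj_invol i : adj i * adj i = 1.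
Proof. exact: tperm2. Qed.

(** Conjugation by one adjacent transposition shortens the distance between the two points of a
    transposition. *)
Lemma adj_gen (sigma : {perm 'I_m.+1}) : exists e, word_prod adj e = sigma.
Proof.
suff htp k (x y : 'I_m.+1) : (y = x + k.+1 :> nat)%N -> exists e, word_prod adj e = tperm x y.
  have [ts -> _] := prod_tpermP sigma.
  elim: ts => [|[x y] ts [e he]]; first by exists [::]; rewrite word_prod0 big_nil.
  rewrite big_cons -he /=.
  have [exy|] := eqVneq x y; first by exists e; rewrite exy tperm1 mul1g.
  rewrite -val_eqE neq_ltn /= => /orP[h|h].
    have [|f hf] := htp (y - x.+1)%N x y; first by lia.
    by exists (f ++ e); rewrite word_prod_cat hf.
  have [|f hf] := htp (x - y.+1)%N y x; first by lia.
  by exists (f ++ e); rewrite word_prod_cat hf tpermC.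
elim: k x y => [|k IHk] x y hxy.
  have hx : (x < m)%N by have := ltn_ord y; lia.
  exists [:: Ordinal hx]; rewrite word_prod_cons word_prod0 mulg1 /adj_transp.
  by congr tperm; apply: val_inj; rewrite //= /bump; lia.
have hz : (x + k.+1 < m.+1)%N by have := ltn_ord y; lia.
have hz' : (x + k.+1 < m)%N by have := ltn_ord y; lia.
have [e he] := IHk x (Ordinal hz) erefl.
exists (Ordinal hz' :: e ++ [:: Ordinal hz']).
rewrite word_prod_cons word_prod_cat he word_prod_cons word_prod0 mulg1.
set j := Ordinal hz'; rewrite -{1}(invs adj_invol j) -/(conjg _ _) tpermJ.
congr tperm; apply: val_inj; rewrite adjE /=.
  by rewrite !ifN_eq //=; lia.
by rewrite eqxx; lia.
Qed.

(** Strong exchange for the symmetric group, with inversions in the role of negative roots: the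
    letter that reverses the pair exchanges exactly its two members, and it is deleted. *)
Lemma adj_exchange (x y : 'I_m.+1) e : (x < y)%N ->
  (word_prod adj e y < word_prod adj e x)%N ->
  exists2 f, (size f).+1 = size e & word_prod adj f = tperm x y * word_prod adj e.
Proof.
elim: e x y => [|i e IHe] x y hxy; first by rewrite word_prod0 !perm1; lia.
rewrite word_prod_cons !permM => hlt.
have [h|h] := ltnP (adj i x) (adj i y).
  have [f h1 h2] := IHe _ _ h hlt; exists (i :: f); first by rewrite /= h1.
  rewrite word_prod_cons h2 mulgA mulgA; congr (_ * _).
  by rewrite -(tpermJ x y) conjgE (invs adj_invol) !mulgA adj_invol mul1g.
have [hx hy] : (x = i :> nat)%N /\ (y = i.+1 :> nat)%N.
  by move: h; rewrite !adjE; do ![case: eqP => ?]; lia.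
exists e => //; suff -> : tperm x y = adj i by rewrite mulgA adj_invol mul1g.
by congr tperm; apply: val_inj; rewrite /= ?hx ?hy.
Qed.

(** A new letter in front of a reduced word creates an inversion and never undoes one. Hence only
    the order required by [hurwitz_arrange] occurs. *)
Lemma adj_reduced_lt i e : reduced adj (i :: e) ->
  (word_prod adj e (widen_ord (leqnSn m) i) < word_prod adj e (lift ord0 i))%N.
Proof.
move=> hred; rewrite ltnNge; apply/negP; rewrite leq_eqVlt => /orP[|h].
  by rewrite val_eqE => /eqP/perm_inj/(congr1 val); rewrite /= /bump; lia.
have [|f h1 h2] := @adj_exchange (widen_ord (leqnSn m) i) (lift ord0 i) e _ h.
  by rewrite /= /bump; lia.
have hle : (size (i :: e) <= size f)%N by apply: hred; rewrite word_prod_cons h2.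
by move: hle; rewrite /= -h1 ltnNge leqnSn.
Qed.

Definition perm_seq (sigma : {perm 'I_m.+1}) : seq nat :=
  [seq val (sigma i) | i <- enum 'I_m.+1].

Lemma size_perm_seq sigma : size (perm_seq sigma) = m.+1.
Proof. by rewrite size_map size_enum_ord. Qed.

Lemma nth_perm_seq sigma (i : 'I_m.+1) : nth 0%N (perm_seq sigma) i = sigma i.
Proof. by rewrite (nth_map i) ?size_enum_ord ?nth_ord_enum. Qed.

Lemma perm_seq1 : perm_seq 1 = iota 0 m.+1.
Proof. by rewrite -val_enum_ord; apply: eq_map => i; rewrite perm1. Qed.

Lemma perm_seq_uniq sigma : uniq (perm_seq sigma).
Proof. by rewrite map_inj_uniq ?enum_uniq // => i j /val_inj/perm_inj. Qed.

(** In [adj j * sigma] the transposition acts first, so neighbouring positions of the one-line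
    notation are exchanged, not values. *)
Lemma perm_seq_adj (sigma : {perm 'I_m.+1}) (j : 'I_m) :
  exists l1 l2, [/\ size l1 = j,
    perm_seq sigma = l1 ++ val (sigma (widen_ord (leqnSn m) j)) :: val (sigma (lift ord0 j)) :: l2 &
    perm_seq (adj j * sigma) = l1 ++ val (sigma (lift ord0 j)) :: val (sigma (widen_ord (leqnSn m) j)) :: l2].
Proof.
set a := val (sigma (widen_ord (leqnSn m) j)); set b := val (sigma (lift ord0 j)).
have hj := ltn_ord j.
have ea : nth 0%N (perm_seq sigma) j = a by exact: (nth_perm_seq sigma (widen_ord (leqnSn m) j)).
have eb : nth 0%N (perm_seq sigma) j.+1 = b by exact: (nth_perm_seq sigma (lift ord0 j)).
exists (take j (perm_seq sigma)), (drop j.+2 (perm_seq sigma)).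
have hsz : size (take j (perm_seq sigma)) = j by rewrite size_takel // size_perm_seq; lia.
have e1 : perm_seq sigma = take j (perm_seq sigma) ++ a :: b :: drop j.+2 (perm_seq sigma).
  rewrite -ea -eb -!drop_nth ?size_perm_seq ?cat_take_drop //; lia.
split=> //; apply: (@eq_from_nth _ 0%N).
  by rewrite size_perm_seq -(size_perm_seq sigma) {1}e1 !size_cat.
move=> i; rewrite size_perm_seq => hi.
rewrite (nth_perm_seq _ (Ordinal hi)) permM nth_cat hsz.
have hval (k : nat) (hk : (k < m.+1)%N) : adj j (Ordinal hi) = k :> nat ->
    val (sigma (adj j (Ordinal hi))) = nth 0%N (perm_seq sigma) k.
  by move=> e; rewrite (nth_perm_seq _ (Ordinal hk)); congr (val (sigma _)); apply: val_inj.
have [hij|hij] := ltnP i j.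
  rewrite nth_take // -(hval i) // adjE /=.
  by rewrite !ifN_eq //=; lia.
have [e|hij1] := eqVneq i j.
  have -> : (i - j = 0)%N by lia.
  rewrite /= -eb; apply: hval; first by lia.
  by rewrite adjE /= e eqxx.
have [e|hij2] := eqVneq i j.+1.
  have -> : (i - j = 1)%N by lia.
  rewrite /= -ea; apply: hval; first by lia.
  by rewrite adjE /= e eqxx ifN_eq //; lia.
have -> : (i - j = (i - j.+2).+2)%N by lia.
rewrite /= nth_drop; have -> : (j.+2 + (i - j.+2) = i)%N by lia.
by apply: hval => //; rewrite adjE /= (negPf hij1) (negPf hij2).
Qed.

Lemma perm_seq_permutations :
  perm_eq [seq perm_seq sigma | sigma <- enum {perm 'I_m.+1}] (permutations (iota 0 m.+1)).
Proof.
have hinj : injective perm_seq.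
  move=> p q h; apply/permP => i; apply: val_inj => /=.
  by rewrite -!nth_perm_seq h.
have hu : uniq [seq perm_seq sigma | sigma <- enum {perm 'I_m.+1}].
  by rewrite map_inj_uniq ?enum_uniq.
have [| |_ hmem] := @uniq_min_size _ _ (permutations (iota 0 m.+1)) hu.
- move=> _ /mapP[sigma _ ->]; rewrite mem_permutations.
  rewrite uniq_perm ?iota_uniq ?perm_seq_uniq //.
  have [| |_ //] := @uniq_min_size _ _ (iota 0 m.+1) (perm_seq_uniq sigma).
    by move=> _ /mapP[i _ ->]; rewrite mem_iota /=.
  by rewrite size_perm_seq size_iota.
- by rewrite size_permutations ?iota_uniq // size_iota size_map -cardE card_Sn.
by apply: uniq_perm; rewrite ?permutations_uniq.
Qed.

End AdjacentTranspositions.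

(** * The Hurwitz action of a permutation and the sum over all permutations *)

Section Hurwitz.
Variables (R : realType) (gT : finGroupType) (n : nat) (s : 'I_n -> gT).
Hypothesis hW : simply_laced_weyl_group s.

Local Notation V := 'rV[R]_n.
Local Notation C := R[i].
Local Notation refl := (@refl R gT n s).
Local Notation isroot := (@is_root R gT n s).
Local Notation ext := (@ext R gT n s).
Local Notation pairing := (@pairing R gT n s).

(* The braiding on monomials in root vectors is the Hurwitz action. *)
Definition hurwitz (i : nat) (r : seq V) : seq V :=
  if drop i r is a :: b :: q then take i r ++ refl a b :: a :: q else r.

(* The letter of index i has crossed exactly those letters j < i that now stand
   to its right. *)
Fixpoint arrange (r : seq V) (l : seq nat) : seq V :=
  if l is i :: l' then
    foldr refl (nth 0 r i) [seq nth 0 r j | j <- iota 0 i & j \in l'] :: arrange r l'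
  else [::].

Lemma hurwitz_cons i a r : hurwitz i.+1 (a :: r) = a :: hurwitz i r.
Proof. by rewrite /hurwitz /=; case: (drop i r) => [|b [|c q]]. Qed.

(** As a < b, the exchange adds one crossing: b now also crosses a, while a crosses the same letters
    as before. The letters below a act on both, and conjugation by them turns r_a into the
    reflection in the arranged letter a. *)
Lemma hurwitz_arrange r (l1 : seq nat) (a b : nat) (l2 : seq nat) : all isroot r ->
  uniq (l1 ++ a :: b :: l2) -> all (fun j => (j < size r)%N) (l1 ++ a :: b :: l2) ->
  (a < b)%N ->
  hurwitz (size l1) (arrange r (l1 ++ a :: b :: l2)) = arrange r (l1 ++ b :: a :: l2).
Proof.
move=> hr; elim: l1 => [|x l1 IHl] /=; last first.
  move=> /andP[_ hu] /andP[_ hs] hab; rewrite hurwitz_cons IHl //; congr (foldr _ _ _ :: _).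
  by congr map; apply: eq_filter => j; rewrite !mem_cat !inE (orbCA (j == a)).
rewrite inE negb_or => /and3P[/andP[_ ha] hb _] /and3P[has hbs _] hab.
rewrite /hurwitz /=.
have -> : [seq j <- iota 0 a | j \in b :: l2] = [seq j <- iota 0 a | j \in l2].
  by apply: eq_in_filter => j; rewrite mem_iota inE => h; case: eqP => //; lia.
have e : iota 0 b = iota 0 a ++ a :: iota a.+1 (b - a.+1).
  by rewrite -{1}(subnKC hab) addSnnS iotaD.
rewrite e !filter_cat /= inE eqxx (negPf ha) /=.
have -> : [seq j <- iota 0 a | j \in a :: l2] = [seq j <- iota 0 a | j \in l2].
  by apply: eq_in_filter => j; rewrite mem_iota inE => h; case: eqP => //; lia.
have -> : [seq j <- iota a.+1 (b - a.+1) | j \in a :: l2] = [seq j <- iota a.+1 (b - a.+1) | j \in l2].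
  by apply: eq_in_filter => j; rewrite mem_iota inE => h; case: eqP => //; lia.
rewrite !map_cat /= !foldr_cat /= foldr_refl_refl //.
apply/allP => z /mapP[j + ->]; rewrite mem_filter mem_iota => /andP[_ hj].
apply: (allP hr); apply: mem_nth.
by rewrite add0n in hj; exact: ltn_trans hj has.
Qed.

Lemma arrange_iota r : arrange r (iota 0 (size r)) = r.
Proof.
suff h k c : arrange r (iota k c) = [seq nth 0 r j | j <- iota k c].
  by rewrite h; apply: mkseq_nth.
elim: c k => //= c IHc k; rewrite IHc (eq_in_filter (a2 := pred0)) ?filter_pred0 //.
by move=> j; rewrite !mem_iota /=; lia.
Qed.

Lemma hurwitz_reduced m e r : size r = m.+1 -> all isroot r ->
  reduced (@adj_transp m) e ->
  foldr (fun i : 'I_m => hurwitz i) r e = arrange r (perm_seq (word_prod (@adj_transp m) e)).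
Proof.
move=> hs hr; elim: e => [|j e IHe] hred /=.
  by rewrite word_prod0 perm_seq1 -hs arrange_iota.
rewrite IHe; last exact: reduced_behead hred.
have hlt := adj_reduced_lt hred.
have [l1 [l2 [h1 h2 h3]]] := perm_seq_adj (word_prod (@adj_transp m) e) j.
rewrite word_prod_cons h3 h2 -h1 hurwitz_arrange // -h2 ?perm_seq_uniq //.
by apply/allP => _ /mapP[i _ ->]; rewrite hs ltn_ord.
Qed.

Fixpoint coef (g k : seq V) : C :=
  match g, k with
  | [::], [::] => 1
  | c :: g', b :: k' => rcoef c b * coef g' k'
  | _, _ => 0
  end.

Lemma ext_map (T : eqType) (f : T -> V) (q : seq T) : uniq q ->
  ext (map f q) = [seq (foldr refl (f x) (map f (take (index x q) q)), map f (rem x q)) | x <- q].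
Proof.
elim: q => //= a q IHq /andP[ha hq]; rewrite eqxx /= IHq // -map_comp; congr (_ :: _).
apply/eq_in_map => x hx /=.
by have -> : (a == x) = false by apply: contraNF ha => /eqP ->.
Qed.

Lemma mem_take_sorted (q : seq nat) x j : sorted ltn q -> x \in q ->
  (j \in take (index x q) q) = (j \in q) && (j < x)%N.
Proof.
elim: q => //= a q IHq hp; have /allP hmin := order_path_min ltn_trans hp.
rewrite inE; have [->|hne] := eqVneq x a => /=.
  move=> _; rewrite inE; apply/esym/negP => /andP[/orP[/eqP ->|/hmin]]; first by rewrite ltnn.
  by move=> h1 h2; have := ltn_trans h1 h2; rewrite ltnn.
move=> hx; rewrite /= !inE IHq ?(path_sorted hp) //.
by have [->|//] := eqVneq j a; rewrite hmin.
Qed.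

(** Permutations are grouped by their first letter x. It has crossed all smaller letters of q, and
    as q is sorted these are the letters before x, just as in [ext]. *)
Lemma sum_permutations r g (q : seq nat) : sorted ltn q ->
  \sum_(l <- permutations q) coef g (arrange r l) = pairing g [seq nth 0 r j | j <- q].
Proof.
elim: g q => [|c g IHg] q hq /=.
  case: q hq => [|x q] hq; first by rewrite big_cons big_nil addr0.
  rewrite big_seq big1 // => l; rewrite mem_permutations => /perm_size.
  by case: l.
have hu : uniq q by move: hq; rewrite ltn_sorted_uniq_leq => /andP[].
rewrite ext_map // big_map.
have [->|hne] := eqVneq q [::]; first by rewrite big_cons !big_nil addr0.
have hsz : (0 < size q)%N by case: (q) hne.
rewrite (perm_big _ (permutationsE hsz)) undup_id // big_flatten big_map.
rewrite [LHS]big_seq [RHS]big_seq; apply: eq_bigr => x hx; rewrite big_map /=.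
rewrite -IHg; last by apply: subseq_sorted hq; [exact: ltn_trans|exact: rem_subseq].
rewrite mulr_sumr [LHS]big_seq [RHS]big_seq; apply: eq_bigr => l.
rewrite mem_permutations => /perm_mem hl; congr (rcoef _ (foldr _ _ _) * _).
congr map; apply: (irr_sorted_eq ltn_trans ltnn).
- by apply: sorted_filter; [exact: ltn_trans|exact: iota_ltn_sorted].
- exact: take_sorted.
move=> j; rewrite mem_filter mem_iota add0n /= hl mem_take_sorted //.
rewrite rem_filter // mem_filter /=; case: (ltngtP j x); rewrite ?andbF ?andbT //=.
Qed.

End Hurwitz.

(** * The defining ideal of the Nichols algebra *)

Section LinearExtensionTheory.
Variables (C : nzRingType) (K : choiceType) (V : lmodType C).

Lemma linextEw (f : K -> V) (d : {fset K}) (a : {malg C[K]}) :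
  fsubset (msupp a) d -> linext f a = \sum_(k <- d) a@_k *: f k.
Proof.
move=> le; rewrite /linext (big_fset_incl _ le) => //= k _ /mcoeff_outdom ->.
by rewrite scale0r.
Qed.

Fact linext_is_linear (f : K -> V) : linear (linext f).
Proof.
move=> c a b; pose d := fsetU (msupp a) (msupp b).
have ha : fsubset (msupp a) d by exact: fsubsetUl.
have hb : fsubset (msupp b) d by exact: fsubsetUr.
have hab : fsubset (msupp (c *: a + b)) d.
  apply: fsubset_trans (msuppD_le _ _) _; apply: fsetSU; exact: msuppZ_le.
rewrite (linextEw _ ha) (linextEw _ hb) (linextEw _ hab) scaler_sumr -big_split.
by apply: eq_bigr => k _; rewrite mcoeffD mcoeffZ scalerDl scalerA.
Qed.

HB.instance Definition _ (f : K -> V) :=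
  GRing.isLinear.Build C {malg C[K]} V *:%R (linext f) (linext_is_linear f).

Lemma linextU (f : K -> V) c k : linext f << c *g k >> = c *: f k.
Proof. by rewrite (linextEw _ msuppU_le) big_seq_fset1 mcoeffUU. Qed.

Lemma linextD (f : K -> V) a b : linext f (a + b) = linext f a + linext f b.
Proof. exact: linearD. Qed.

Lemma malgUZ (c : C) (k : K) : << c *g k >> = c *: << k >> :> {malg C[K]}.
Proof. by apply/malgP => l; rewrite mcoeffZ !mcoeffU mulrnAr mulr1. Qed.

Lemma malg_ind (Q : {malg C[K]} -> Prop) :
  Q 0 -> (forall k, Q << k >>) -> (forall c a b, Q a -> Q b -> Q (c *: a + b)) ->
  forall a, Q a.
Proof.
move=> Q0 QU QD a; rewrite (monalgE a).
apply: (big_ind (fun b => Q b)) => // [b c hb hc|k _].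
  by have := QD 1 b c hb hc; rewrite scale1r.
by rewrite malgUZ -[_ *: _]addr0; apply: QD.
Qed.

End LinearExtensionTheory.

Lemma linext_funP (C : comNzRingType) (K : choiceType) (V : lmodType C)
  (f g h : K -> V) c (a : {malg C[K]}) : (forall k, h k = c *: f k + g k) ->
  linext h a = c *: linext f a + linext g a.
Proof.
move=> e; rewrite /linext scaler_sumr -big_split; apply: eq_bigr => k _.
by rewrite e scalerDr !scalerA mulrC.
Qed.

Section MonoidAlgebra.
Variables (C : comNzRingType) (K : monomType).

Lemma malg_mulU (k l : K) : << k >> * << l >> = << mmul k l >> :> {malg C[K]}.
Proof. by rewrite malgM_def fgmulUU mulr1. Qed.

Lemma malg_scalerAr (c : C) (a b : {malg C[K]}) : a * (c *: b) = c *: (a * b).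
Proof.
apply/malgP => k; rewrite mcoeffZ.
rewrite (mcoeffMlw _ (fsubset_refl _) (msuppZ_le c b)).
rewrite (mcoeffMlw _ (fsubset_refl _) (fsubset_refl _)) mulr_sumr; apply: eq_bigr => k1 _.
rewrite mulr_sumr; apply: eq_bigr => k2 _.
by rewrite mcoeffZ mulrnAr mulrCA.
Qed.

End MonoidAlgebra.

(** * The ideal as the radical of the pairing, and its stability *)

Section NicholsIdeal.
Variables (R : realType) (gT : finGroupType) (n : nat) (s : 'I_n -> gT).
Hypothesis hW : simply_laced_weyl_group s.

Local Notation V := 'rV[R]_n.
Local Notation C := R[i].
Local Notation P := (posroot R s).
Local Notation word := (fword P).
Local Notation T := {malg R[i][word]}.
Local Notation act := (@geom_act R gT n s).
Local Notation refl := (@refl R gT n s).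
Local Notation isroot := (@is_root R gT n s).
Local Notation posr := (@is_posroot R gT n s).
Local Notation rr := (@root_refl R gT n s).
Local Notation ext := (@ext R gT n s).
Local Notation pairing := (@pairing R gT n s).
Local Notation xroot := (@xroot R gT n s).
Local Notation vals := (map (val : P -> V)).
Local Notation ideal := (@nichols_ideal R gT n s).

HB.instance Definition _ i :=
  GRing.isLinear.Build C T T *:%R (@braid R gT n s i) (linext_is_linear _).
HB.instance Definition _ m :=
  GRing.isLinear.Build C T T *:%R (@hpart R gT n s m) (linext_is_linear _).
HB.instance Definition _ u :=
  GRing.isLinear.Build C T T *:%R (@wact R gT n s u) (linext_is_linear _).
HB.instance Definition _ :=
  GRing.isLinear.Build C T T *:%R (@rho R gT n s) (linext_is_linear _).

Definition xmono (r : seq V) : T := \prod_(a <- r) xroot a.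

Lemma xmonoE r : xmono r = \prod_(a <- r) xroot a.
Proof. by []. Qed.

Lemma xmono_nil : xmono [::] = 1.
Proof. exact: big_nil. Qed.
Lemma xmono_cons a r : xmono (a :: r) = xroot a * xmono r.
Proof. exact: big_cons. Qed.
Lemma xmono_cat r1 r2 : xmono (r1 ++ r2) = xmono r1 * xmono r2.
Proof. exact: big_cat. Qed.

Lemma val_posr (p : P) : posr (val p).
Proof. exact: valP p. Qed.

Lemma xroot_val (p : P) : xroot (val p) = xpos p.
Proof. by rewrite /Defs.xroot valK. Qed.

Lemma xrootN a : xroot (- a) = - xroot a.
Proof.
rewrite /Defs.xroot opprK; case: insubP => [p hp _|hn]; case: insubP => [q hq _|hm].
- by have := posr_opp hW hq; rewrite [posr _]hp.
- by rewrite opprK.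
- by [].
- by rewrite oppr0.
Qed.

Lemma mono_cons (p : P) (k : word) : mono (p :: k : word) = xpos p * mono k.
Proof. by rewrite /mono /xpos /mono malg_mulU. Qed.

Lemma mono_xmono (k : word) : mono k = xmono (vals k).
Proof.
elim: k => [|p k IHk]; first by rewrite xmono_nil.
by rewrite mono_cons IHk /= xmono_cons xroot_val.
Qed.

Lemma xmono_sign r1 a r2 : xmono (r1 ++ - a :: r2) = - xmono (r1 ++ a :: r2).
Proof. by rewrite !xmono_cat !xmono_cons xrootN mulNr mulrN. Qed.

(** Letters are made positive one at a time, the sign being the same on both sides. Facts about the
    monomial basis extend in this way to words in arbitrary roots. *)
Lemma sign_ext (Z : zmodType) (F G : seq V -> Z) :
  (forall r1 a r2, F (r1 ++ - a :: r2) = - F (r1 ++ a :: r2)) ->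
  (forall r1 a r2, G (r1 ++ - a :: r2) = - G (r1 ++ a :: r2)) ->
  (forall k, F (vals k) = G (vals k)) ->
  forall r, all isroot r -> F r = G r.
Proof.
move=> hF hG h r; suff hk k : all isroot r -> F (vals k ++ r) = G (vals k ++ r).
  exact: hk [::].
elim: r k => [|a r IHr] k; first by rewrite cats0 h.
have hpos b : posr b -> all isroot r -> F (vals k ++ b :: r) = G (vals k ++ b :: r).
  move=> hb hr; have := IHr (rcons k (exist _ b hb)) hr.
  by rewrite map_rcons -cats1 -catA.
move=> /= /andP[ha hr]; have [ha'|ha'] := root_cases hW ha; first exact: hpos.
by rewrite -(opprK a) hF hG hpos.
Qed.

Lemma wact_xmono u r : all isroot r -> wact u (xmono r) = xmono (map (act u) r).
Proof.
move: r; apply: sign_ext => [r1 a r2|r1 a r2|k].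
- by rewrite xmono_sign linearN.
- by rewrite !map_cat /= geom_actN // xmono_sign.
by rewrite -mono_xmono /wact linextU scale1r /xmono !big_map.
Qed.

Lemma hurwitz_sign i r1 a r2 :
  xmono (hurwitz s i (r1 ++ - a :: r2)) = - xmono (hurwitz s i (r1 ++ a :: r2)).
Proof.
elim: i r1 => [|i IHi] [|b r1] /=; last 2 first.
- by rewrite !hurwitz_cons !xmono_cons xrootN mulNr.
- by rewrite !hurwitz_cons !xmono_cons IHi mulrN.
- rewrite /hurwitz /=; case: r2 => [|b r2]; rewrite !xmono_cons xrootN ?mulNr //.
  by rewrite reflNl // mulrN.
rewrite /hurwitz /=; case: r1 => [|c r1] /=; rewrite !xmono_cons.
  by rewrite reflN // xrootN mulNr.
by rewrite xmono_sign !mulrN.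
Qed.

Lemma braid_xmono i r : all isroot r -> braid i (xmono r) = xmono (hurwitz s i r).
Proof.
move: r; apply: sign_ext => [r1 a r2|r1 a r2|k].
- by rewrite xmono_sign linearN.
- exact: hurwitz_sign.
rewrite -mono_xmono /braid linextU scale1r /hurwitz -map_drop.
case: (drop i k) => [|a [|b q]]; rewrite -?mono_xmono //.
have hw : wact (rr (val a)) (xpos b) = xroot (refl (val a) (val b)).
  have := wact_xmono (rr (val a)) (r := [:: val b]).
  rewrite !xmono_cons xmono_nil !mulr1 xroot_val => -> //=.
    by rewrite geom_act_rr // posr_root // val_posr.
  by rewrite posr_root // val_posr.
rewrite -map_take /= hw xmono_cat (xmono_cons (refl _ _)) (xmono_cons (val a)).
by rewrite -(mono_xmono q) -(mono_xmono (take i k)) (xroot_val a) -[LHS]mulrA -[LHS]mulrA.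
Qed.

Lemma hurwitz_roots i r : all isroot r -> all isroot (hurwitz s i r).
Proof.
elim: i r => [|i IHi] [|a r] //; last by rewrite hurwitz_cons /= => /andP[-> /IHi].
by case: r => [|b r] //= /and3P[ha hb hr]; rewrite /hurwitz /= isroot_refl // ha.
Qed.

Lemma foldr_braid m e r : all isroot r ->
  foldr (fun i : 'I_m => braid i) (xmono r) e = xmono (foldr (fun i : 'I_m => hurwitz s i) r e).
Proof.
move=> hr; elim: e => //= i e ->; rewrite braid_xmono //.
by elim: e => //= j e; apply: hurwitz_roots.
Qed.

Lemma mcoeff_xmono r (g : word) : all isroot r -> (xmono r)@_g = coef (vals g) r.
Proof.
move: r; apply: sign_ext => [r1 a r2|r1 a r2|k].
- by rewrite xmono_sign mcoeffN.
- elim: r1 (g) => [|b r1 IHr] [|p h] /=; rewrite ?oppr0 //; first by rewrite rcoefNr mulNr.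
  by rewrite IHr mulrN.
rewrite -mono_xmono /mono mcoeffU1; elim: k (g) => [|q k IHk] [|p h] //=.
rewrite -IHk (rcoef_posr hW) ?val_posr // (inj_eq val_inj) -natrM mulnb.
congr ((nat_of_bool _)%:R); apply/eqP/andP => [[-> ->]|[/eqP -> /eqP ->]] //.
Qed.

Definition lpair (g : seq V) (a : T) : C :=
  linext (fun k : word => pairing g (vals k) : C^o) a.

Lemma lpairP g c a b : lpair g (c *: a + b) = c * lpair g a + lpair g b.
Proof. exact: (linext_is_linear (fun k : word => pairing g (vals k) : C^o) c a b). Qed.

Lemma lpairD g a b : lpair g (a + b) = lpair g a + lpair g b.
Proof. by rewrite -{1}(scale1r a) lpairP mul1r. Qed.

Lemma lpair0 g : lpair g 0 = 0.
Proof. by apply: (addIr (lpair g 0)); rewrite -lpairD !add0r. Qed.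

Lemma lpairZ g c a : lpair g (c *: a) = c * lpair g a.
Proof. by rewrite -(addr0 (c *: a)) lpairP lpair0 addr0. Qed.

Lemma lpairN g a : lpair g (- a) = - lpair g a.
Proof. by rewrite -scaleN1r lpairZ mulN1r. Qed.

Lemma lpair_sum g (I : eqType) (l : seq I) (F : I -> T) :
  lpair g (\sum_(i <- l) F i) = \sum_(i <- l) lpair g (F i).
Proof. exact: (big_morph (lpair g) (lpairD g) (lpair0 g)). Qed.

Lemma lpair_mono g (k : word) : lpair g (mono k) = pairing g (vals k).
Proof. by rewrite /lpair linextU scale1r. Qed.

Lemma lpair_xmono g r : all isroot r -> lpair g (xmono r) = pairing g r.
Proof.
move: r; apply: sign_ext => [r1 a r2|r1 a r2|k].
- by rewrite xmono_sign lpairN.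
- exact: pairing_sign.
by rewrite -mono_xmono lpair_mono.
Qed.

(** Each permutation contributes the word arranged by it, whichever reduced expression is chosen,
    and summing over one-line notations gives the recursion of [pairing]. *)
Lemma braided_fact_xmono r (g : word) : all isroot r ->
  (braided_fact (size r) (xmono r))@_g = pairing (vals g) r.
Proof.
move=> hr; case hm : (size r) => [|m] /=.
  by rewrite mcoeff_xmono // (size0nil hm); case: (g) => [|p h] /=; rewrite ?big_nil.
rewrite raddf_sum /= -[in RHS](mkseq_nth 0 r) -sum_permutations ?iota_ltn_sorted //.
rewrite hm -(perm_big _ (perm_seq_permutations m)) big_map big_enum; apply: eq_bigr => sigma _.
have [h1 h2] := red_wordP (@adj_gen m) sigma.
rewrite foldr_braid // (hurwitz_reduced hW hm hr h2) h1 mcoeff_xmono //.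
apply/allP => a ha; suff : all isroot (arrange s r (perm_seq sigma)) by move/allP/(_ a ha).
rewrite -h1 -(hurwitz_reduced hW hm hr h2).
by elim: (red_word _ _) => //= j e; apply: hurwitz_roots.
Qed.

Fact braided_fact_is_linear m : linear (@braided_fact R gT n s m).
Proof.
move=> c a b; case: m => [//|m] /=; rewrite scaler_sumr -big_split; apply: eq_bigr => sigma _ /=.
by elim: (red_word _ _) => //= j e ->; rewrite linearP.
Qed.

HB.instance Definition _ m :=
  GRing.isLinear.Build C T T *:%R (@braided_fact R gT n s m) (braided_fact_is_linear m).

Lemma mcoeff_braided_fact m a (g : word) :
  (braided_fact m (hpart m a))@_g = (size g == m)%:R * lpair (vals g) a.
Proof.
elim/malg_ind: a => [|k|c a b ha hb]; first by rewrite !linear0 lpair0 mulr0.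
  rewrite -/(mono k) lpair_mono /hpart linextU scale1r.
  have [hk|hk] := eqVneq (size k) m.
    rewrite -hk mono_xmono -[size k](size_map val) braided_fact_xmono; last first.
      by apply/allP => _ /mapP[p _ ->]; apply: posr_root (val_posr p).
    rewrite size_map; have [_|hg] := eqVneq (size g) (size k); first by rewrite mul1r.
    by rewrite mul0r pairing_size // !size_map.
  rewrite linear0 mcoeff0; have [hg|_] := eqVneq (size g) m; last by rewrite mul0r.
  by rewrite mul1r pairing_size // !size_map hg eq_sym.
rewrite (linearP (@hpart R gT n s m)) (linearP (@braided_fact R gT n s m)) mcoeffD mcoeffZ.
rewrite lpairP mulrDr [in RHS]mulrCA.
exact: (congr2 (fun x y => c * x + y) ha hb).
Qed.

Lemma pairing_signl g1 c g2 k : pairing (g1 ++ - c :: g2) k = - pairing (g1 ++ c :: g2) k.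
Proof.
elim: g1 k => [|d g1 IHg] k /=; rewrite -sumrN; apply: eq_bigr => p _.
  by rewrite rcoefNl mulNr.
by rewrite IHg mulrN.
Qed.

Lemma nichols_idealP a : ideal a <-> forall g, all isroot g -> lpair g a = 0.
Proof.
split=> [h|h m]; last first.
  apply/malgP => g; rewrite mcoeff_braided_fact h ?mulr0 ?mcoeff0 //.
  by apply/allP => _ /mapP[p _ ->]; apply: posr_root (val_posr p).
apply: (sign_ext (G := fun=> 0)) => [g1 c g2|g1 c g2|g]; last 1 first.
- have := mcoeff_braided_fact (size g) a g.
  by rewrite eqxx mul1r => <-; rewrite h mcoeff0.
- rewrite /lpair /linext -sumrN; apply: eq_bigr => k _.
  by rewrite pairing_signl; exact: mulrN.
by rewrite oppr0.
Qed.

Lemma ideal0 : ideal 0.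
Proof. by apply/nichols_idealP => g _; rewrite lpair0. Qed.

Lemma idealD a b : ideal a -> ideal b -> ideal (a + b).
Proof.
move=> /nichols_idealP ha /nichols_idealP hb; apply/nichols_idealP => g hg.
by rewrite lpairD ha // hb // addr0.
Qed.

Lemma idealZ c a : ideal a -> ideal (c *: a).
Proof.
move=> /nichols_idealP ha; apply/nichols_idealP => g hg.
by rewrite lpairZ ha // mulr0.
Qed.

Lemma idealN a : ideal a -> ideal (- a).
Proof. by rewrite -scaleN1r; apply: idealZ. Qed.

Lemma idealB a b : ideal a -> ideal b -> ideal (a - b).
Proof. by move=> ha hb; exact: idealD ha (idealN hb). Qed.

Local Notation eqB := (@nichols_eq R gT n s).

Lemma nichols_eq_refl a : eqB a a.
Proof. by rewrite /nichols_eq subrr; apply: ideal0. Qed.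

Lemma nichols_eq_sym a b : eqB a b -> eqB b a.
Proof. by move/idealN; rewrite opprB. Qed.

Lemma nichols_eq_trans b a c : eqB a b -> eqB b c -> eqB a c.
Proof. by move=> h1 h2; have := idealD h1 h2; rewrite addrA subrK. Qed.

Lemma nichols_eqD a b c d : eqB a b -> eqB c d -> eqB (a + c) (b + d).
Proof. by move=> h1 h2; have := idealD h1 h2; rewrite /nichols_eq opprD addrACA. Qed.

(** The braided skew derivation attached to c, adjoint to putting c in front of a test word. *)
Definition skew_deriv (c : V) : T -> T :=
  linext (fun k : word => \sum_(p <- ext (vals k)) rcoef c p.1 *: xmono p.2).

HB.instance Definition _ c :=
  GRing.isLinear.Build C T T *:%R (skew_deriv c) (linext_is_linear _).

Lemma skew_deriv_mono c (k : word) :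
  skew_deriv c (mono k) = \sum_(p <- ext (vals k)) rcoef c p.1 *: xmono p.2.
Proof. by rewrite /skew_deriv linextU scale1r. Qed.

Lemma vals_roots (k : seq P) : all isroot (vals k).
Proof. by apply/allP => _ /mapP[p _ ->]; apply: posr_root (val_posr p). Qed.

Lemma lpair_skew_deriv g c a : lpair g (skew_deriv c a) = lpair (c :: g) a.
Proof.
elim/malg_ind: a => [|k|x a b ha hb]; first by rewrite ?linear0 !lpair0.
  rewrite -/(mono k) skew_deriv_mono lpair_mono lpair_sum /= big_seq [RHS]big_seq.
  apply: eq_bigr => p hp; have /andP[_ hp2] := ext_roots hW (vals_roots k) hp.
  by rewrite lpairZ lpair_xmono.
rewrite (linearP (skew_deriv c)) !lpairP.
exact: (congr2 (fun y z => x * y + z) ha hb).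
Qed.

Lemma xroot_mulP r x (a b : T) : xroot r * (x *: a + b) = x *: (xroot r * a) + xroot r * b.
Proof. by rewrite mulrDr; congr (_ + _); exact: malg_scalerAr. Qed.

(** A Leibniz rule: the letter matched with c is either r or a letter of a that crosses r, and the
    resulting reflection is transferred to c. *)
Lemma lpair_mull g c r a : isroot r ->
  lpair (c :: g) (xroot r * a) = rcoef c r * lpair g a + lpair g (xroot r * skew_deriv (refl r c) a).
Proof.
move=> hr; elim/malg_ind: a => [|k|x a b ha hb].
- by rewrite linear0 !mulr0 !lpair0 mulr0 addr0.
- rewrite -/(mono k) skew_deriv_mono lpair_mono mono_xmono -xmono_cons.
  have hk := vals_roots k.
  rewrite lpair_xmono /= ?hr // big_cons big_map; congr (_ + _).
  rewrite mulr_sumr lpair_sum /= big_seq [RHS]big_seq; apply: eq_bigr => p hp.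
  have /andP[_ hp2] := ext_roots hW hk hp.
  by rewrite malg_scalerAr lpairZ -xmono_cons lpair_xmono /= ?hr // rcoef_refl.
rewrite (linearP (skew_deriv _)) !xroot_mulP !lpairP mulrDr addrACA.
rewrite (mulrCA (rcoef c r)) -(mulrDr x).
exact: (congr2 (fun y z => x * y + z) ha hb).
Qed.

Lemma ideal_skew_deriv c a : isroot c -> ideal a -> ideal (skew_deriv c a).
Proof.
move=> hc /nichols_idealP ha; apply/nichols_idealP => g hg.
by rewrite lpair_skew_deriv ha //= hc.
Qed.

(** Induction on the test word with a arbitrary, since the Leibniz rule replaces a by a skew
    derivative, which is again in the ideal. *)
Lemma ideal_mull r a : isroot r -> ideal a -> ideal (xroot r * a).
Proof.
move=> hr ha; apply/nichols_idealP => g; elim: g a ha => [|c g IHg] a ha.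
  move=> _; elim/malg_ind: a {ha} => [|k|x a b ha hb].
  - by rewrite mulr0 lpair0.
  - rewrite -/(mono k) mono_xmono -xmono_cons lpair_xmono //=.
    by rewrite hr vals_roots.
  rewrite xroot_mulP lpairP; apply: etrans (congr2 (fun y z => x * y + z) ha hb) _.
  by rewrite mulr0 addr0.
case/andP=> hc hg; have hd := ideal_skew_deriv (isroot_refl hW hr hc) ha.
rewrite (lpair_mull g c a hr) (IHg _ hd hg) addr0.
by move/nichols_idealP: ha => /(_ g hg) ->; rewrite mulr0.
Qed.

Lemma lpair_wact u g a : lpair g (wact u a) = lpair (map (act u^-1) g) a.
Proof.
elim/malg_ind: a => [|k|x a b ha hb]; first by rewrite ?linear0 !lpair0.
  rewrite -/(mono k) lpair_mono mono_xmono wact_xmono ?vals_roots // lpair_xmono; last first.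
    by apply/allP => _ /mapP[p hp ->]; rewrite isroot_act // (allP (vals_roots k)).
  have hg : map (act u) (map (act u^-1) g) = g.
    by rewrite mapK // => x; exact: geom_actKV.
  by rewrite -{1}hg pairing_act.
rewrite (linearP (@wact R gT n s u)) !lpairP.
exact: (congr2 (fun y z => x * y + z) ha hb).
Qed.

Lemma ideal_wact u a : ideal a -> ideal (wact u a).
Proof.
move=> /nichols_idealP ha; apply/nichols_idealP => g hg; rewrite lpair_wact ha //.
by apply/allP => _ /mapP[p hp ->]; rewrite isroot_act // (allP hg).
Qed.

Lemma nichols_eq_wact u a b : eqB a b -> eqB (wact u a) (wact u b).
Proof. by move/(ideal_wact u); rewrite /nichols_eq linearB. Qed.

Lemma ideal_rho a : ideal a -> ideal (rho a).
Proof.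
move=> /nichols_idealP ha; apply/nichols_idealP => g hg.
suff -> : lpair g (rho a) = lpair (rev_pair s g) a by rewrite ha // rev_pair_roots.
elim/malg_ind: a {ha} => [|k|x a b ha hb]; first by rewrite linear0 !lpair0.
  rewrite -/(mono k) lpair_mono /rho linextU scale1r lpair_mono.
  by rewrite map_rev pairing_rev // vals_roots.
rewrite (linearP (@rho R gT n s)) !lpairP.
exact: (congr2 (fun y z => x * y + z) ha hb).
Qed.

Lemma nichols_eq_rho a b : eqB a b -> eqB (rho a) (rho b).
Proof. by move/ideal_rho; rewrite /nichols_eq linearB. Qed.

Lemma nichols_eq_xmono r1 r2 : all isroot r1 -> all isroot r2 ->
  (forall g, all isroot g -> pairing g r1 = pairing g r2) -> eqB (xmono r1) (xmono r2).
Proof.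
move=> h1 h2 h; apply/nichols_idealP => g hg.
by rewrite lpairD lpairN !lpair_xmono // h // subrr.
Qed.

Lemma lpair_eq g a b : all isroot g -> eqB a b -> lpair g a = lpair g b.
Proof.
move=> hg /nichols_idealP/(_ g hg); rewrite lpairD lpairN.
by move/eqP; rewrite subr_eq0 => /eqP.
Qed.

End NicholsIdeal.

(** * The elements x_{w/v} *)

Section SkewElements.
Variables (R : realType) (gT : finGroupType) (n : nat) (s : 'I_n -> gT).
Hypothesis hW : simply_laced_weyl_group s.

Local Notation P := (posroot R s).
Local Notation word := (fword P).
Local Notation T := {malg R[i][word]}.
Local Notation TT := {malg R[i][(word * word)%type]}.
Local Notation isroot := (@is_root R gT n s).
Local Notation rr := (@root_refl R gT n s).
Local Notation xroot := (@xroot R gT n s).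
Local Notation xmono := (@xmono R gT n s).
Local Notation ideal := (@nichols_ideal R gT n s).
Local Notation eqB := (@nichols_eq R gT n s).
Local Notation lpair := (@lpair R gT n s).
Local Notation "''a_' i" := (@simple_root R n i) (at level 8, i at level 2, format "''a_' i").
Local Notation simple_word := (@simple_word R n).
Local Notation xelt := (@xelt R gT n s).

Let gen := coxeter_gen hW.
Let s2 := coxeter_invol hW.

Lemma tensE (a b : T) :
  tens a b = linext (fun k => linext (fun l => << (k, l) >> : TT) b) a.
Proof.
rewrite /tens /linext; apply: eq_bigr => k _; rewrite scaler_sumr; apply: eq_bigr => l _.
by rewrite malgUZ scalerA.
Qed.

Lemma tensPl c (a b z : T) : tens (c *: a + b) z = c *: tens a z + tens b z.
Proof. rewrite !tensE; exact: linext_is_linear. Qed.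

Lemma tensPr c (a b z : T) : tens z (c *: a + b) = c *: tens z a + tens z b.
Proof.
by rewrite !tensE; apply: linext_funP => k; exact: linext_is_linear.
Qed.

Lemma tensDl (a b z : T) : tens (a + b) z = tens a z + tens b z.
Proof. by have := tensPl 1 a b z; rewrite !scale1r. Qed.
Lemma tensDr (a b z : T) : tens z (a + b) = tens z a + tens z b.
Proof. by have := tensPr 1 a b z; rewrite !scale1r. Qed.
Lemma tens0l (z : T) : tens 0 z = 0.
Proof. by apply: (addIr (tens 0 z)); rewrite -tensDl !add0r. Qed.
Lemma tens0r (z : T) : tens z 0 = 0.
Proof. by apply: (addIr (tens z 0)); rewrite -tensDr !add0r. Qed.
Lemma tensNr (a z : T) : tens z (- a) = - tens z a.
Proof. by apply: (addIr (tens z a)); rewrite -tensDr !addNr tens0r. Qed.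

Lemma tens_mono (k l : word) : tens (mono k) (mono l) = << (k, l) >> :> TT.
Proof. by rewrite tensE !linextU !scale1r. Qed.

Lemma twisted_mulE (z t : TT) : twisted_mul z t =
  linext (fun p => linext (fun q =>
    tens (mono p.1 * wact (wdeg p.2) (mono q.1)) (mono p.2 * mono q.2)) t) z.
Proof.
rewrite /twisted_mul /linext; apply: eq_bigr => p _; rewrite scaler_sumr.
by apply: eq_bigr => q _; rewrite scalerA.
Qed.

Lemma twisted_mulPr c (z t u : TT) :
  twisted_mul z (c *: t + u) = c *: twisted_mul z t + twisted_mul z u.
Proof.
by rewrite !twisted_mulE; apply: linext_funP => k; exact: linext_is_linear.
Qed.

Definition prim_mul (a : P) (t : TT) : TT :=
  twisted_mul (tens (xpos a) 1 + tens 1 (xpos a)) t.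

Lemma prim_mulP a c (t u : TT) : prim_mul a (c *: t + u) = c *: prim_mul a t + prim_mul a u.
Proof. exact: twisted_mulPr. Qed.

Lemma prim_mulD a (t u : TT) : prim_mul a (t + u) = prim_mul a t + prim_mul a u.
Proof. by have := prim_mulP a 1 t u; rewrite !scale1r. Qed.

Lemma prim_mul0 a : prim_mul a 0 = 0.
Proof. by apply: (addIr (prim_mul a 0)); rewrite -prim_mulD !add0r. Qed.

Lemma prim_mul_sum a (J : Type) (l : seq J) (F : J -> TT) :
  prim_mul a (\sum_(j <- l) F j) = \sum_(j <- l) prim_mul a (F j).
Proof. exact: (big_morph (prim_mul a) (prim_mulD a) (prim_mul0 a)). Qed.

Lemma twisted_mulDl (z t u : TT) : twisted_mul (z + t) u = twisted_mul z u + twisted_mul t u.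
Proof. by rewrite !twisted_mulE linextD. Qed.

Lemma twisted_mulU (p q : word * word) : twisted_mul << p >> << q >> =
  tens (mono p.1 * wact (wdeg p.2) (mono q.1)) (mono p.2 * mono q.2).
Proof. by rewrite twisted_mulE linextU scale1r linextU scale1r. Qed.

Lemma wact1_mono (k : word) : wact 1 (mono k) = mono k.
Proof.
rewrite mono_xmono wact_xmono // ?vals_roots //.
by congr xmono; rewrite -[RHS]map_id; apply: eq_map => x; rewrite geom_act1.
Qed.

Lemma prim_mul_mono a (k l : word) : prim_mul a (tens (mono k) (mono l)) =
  tens (xpos a * mono k) (mono l) + tens (wact (rr (val a)) (mono k)) (xpos a * mono l).
Proof.
have hz : tens (xpos a) 1 + tens 1 (xpos a) = << ([:: a] : word, [::] : word) >> + << ([::] : word, [:: a] : word) >> :> TT.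
  exact: (congr2 +%R (tens_mono [:: a] [::]) (tens_mono [::] [:: a])).
apply: etrans (congr2 (@twisted_mul R gT n s) hz (tens_mono k l)) _.
apply: etrans (twisted_mulDl _ _ _) _.
apply: (congr2 +%R).
  apply: etrans (twisted_mulU _ _) _; apply: (congr2 (@tens R gT n s)); last exact: mul1r.
  by apply: (congr1 ( *%R (xpos a))); rewrite /wdeg big_nil; exact: wact1_mono.
apply: etrans (twisted_mulU _ _) _; apply: (congr2 (@tens R gT n s)); last exact: erefl.
by rewrite /wdeg big_seq1; exact: mul1r.
Qed.

Lemma xpos_mulP (a : P) c (u t : T) : xpos a * (c *: u + t) = c *: (xpos a * u) + xpos a * t.
Proof. by rewrite -xroot_val; exact: xroot_mulP. Qed.

Lemma prim_mul_tens a (p q : T) : prim_mul a (tens p q) =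
  tens (xpos a * p) q + tens (wact (rr (val a)) p) (xpos a * q).
Proof.
elim/malg_ind: p => [|k|c p p' hp hp'].
- by rewrite tens0l prim_mul0 mulr0 (linear0 (@wact R gT n s _)) !tens0l addr0.
- elim/malg_ind: q => [|l|c q q' hq hq'].
  + by rewrite tens0r prim_mul0 mulr0 !tens0r addr0.
  + exact: prim_mul_mono.
  set W := wact _ _ in hq hq' *.
  have e1 := tensPr c q q' (xpos a * mono k).
  have e2 := etrans (congr1 (tens W) (xpos_mulP a c q q')) (tensPr c _ _ W).
  apply: etrans (congr1 (prim_mul a) (tensPr c q q' (mono k))) _.
  apply: etrans (prim_mulP a c _ _) _.
  apply: etrans (congr2 (fun y z => c *: y + z) hq hq') _.
  by rewrite scalerDr addrACA; exact: esym (congr2 +%R e1 e2).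
have e1 := etrans (congr1 (fun t => tens t q) (xpos_mulP a c p p')) (tensPl c _ _ q).
have e2 := etrans (congr1 (fun t => tens t (xpos a * q)) (linearP (@wact R gT n s (rr (val a))) c p p')) (tensPl c _ _ (xpos a * q)).
apply: etrans (congr1 (prim_mul a) (tensPl c p p' q)) _.
apply: etrans (prim_mulP a c _ _) _.
apply: etrans (congr2 (fun y z => c *: y + z) hp hp') _.
by rewrite scalerDr addrACA; exact: esym (congr2 +%R e1 e2).
Qed.

Lemma coproduct_nil : coproduct (mono ([::] : word)) = tens 1 1.
Proof. by rewrite /coproduct linextU scale1r. Qed.

Lemma coproduct_cons a (k : word) :
  coproduct (mono (a :: k : word)) = prim_mul a (coproduct (mono k)).
Proof.
by apply: etrans (linextU _ _ _) _; rewrite scale1r /=; congr prim_mul;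
   apply/esym/(etrans (linextU _ _ _)); rewrite scale1r.
Qed.

Definition sroot (i : 'I_n) : P := exist _ 'a_i (posr_simple R hW i).

Definition xword (e : seq 'I_n) : T := xmono (simple_word e).

Lemma xword_mono e : xword e = mono (map sroot e : word).
Proof. by rewrite mono_xmono -map_comp. Qed.

Lemma xeltE w : xelt w = xword (red_word s w).
Proof. by rewrite /Defs.xelt /xword xmonoE big_map. Qed.

Lemma xword_cons i e : xword (i :: e) = xroot 'a_i * xword e.
Proof. exact: xmono_cons. Qed.

Lemma lpair_xword g e : all isroot g ->
  lpair g (xword e) = (size g == size e)%:R * wpair s g (word_prod s e).
Proof. by move=> hg; rewrite lpair_xmono ?simple_word_roots // pairing_simple_word. Qed.

Lemma xword_eq e f : size e = size f -> word_prod s e = word_prod s f -> eqB (xword e) (xword f).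
Proof.
move=> h1 h2; apply: nichols_eq_xmono; rewrite ?simple_word_roots // => g hg.
by rewrite !pairing_simple_word // h1 h2.
Qed.

Lemma xword_nonreduced e : (len s (word_prod s e) < size e)%N -> ideal (xword e).
Proof.
move=> h; apply/nichols_idealP => // g hg; rewrite lpair_xword //.
have [hs|_] := eqVneq (size g) (size e); last by rewrite mul0r.
rewrite mul1r; apply/eqP/negPn/negP => hne.
by have := wpair_len hW hg hne; rewrite hs leqNgt h.
Qed.

Lemma mul_xelt_up i v : (len s v < len s (s i * v))%N ->
  eqB (xroot 'a_i * xelt v) (xelt (s i * v)%g).
Proof.
move=> h; rewrite !xeltE -xword_cons; apply: xword_eq.
  by rewrite /= -!/(len s _); have := len_mull_cases hW i v; lia.
by rewrite word_prod_cons !(word_prod_red gen).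
Qed.

Lemma mul_xelt_down i v : (len s (s i * v) < len s v)%N -> ideal (xroot 'a_i * xelt v).
Proof.
move=> h; rewrite xeltE -xword_cons; apply: xword_nonreduced.
by rewrite word_prod_cons (word_prod_red gen) /= -/(len s v); exact: ltnW.
Qed.

Lemma xelt_dual v u : lpair (simple_word (red_word s v)) (xelt u) = (u == v)%:R.
Proof.
have [h1 h2] := red_wordP gen v.
rewrite xeltE lpair_xword ?simple_word_roots // wpair_dual // h1 (word_prod_red gen).
have [->|_] := eqVneq u v; last by rewrite mulr0.
by rewrite size_map eqxx mulr1.
Qed.

(** Computing the coproduct of x_w creates errors in the second factor only, where products x_i x_v
    are simplified. This smaller space is preserved because the ideal is stable under left
    multiplication. *)
Definition tens_ideal (z : TT) : Prop :=
  exists2 l : seq (T * T), (forall p, p \in l -> ideal p.2) & z = \sum_(p <- l) tens p.1 p.2.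

Lemma tens_ideal0 : tens_ideal 0.
Proof. by exists [::] => //; rewrite big_nil. Qed.

Lemma tens_idealD z t : tens_ideal z -> tens_ideal t -> tens_ideal (z + t).
Proof.
move=> [l1 h1 ->] [l2 h2 ->]; exists (l1 ++ l2); last by rewrite big_cat.
by move=> p; rewrite mem_cat => /orP[/h1|/h2].
Qed.

Lemma tens_ideal_tens a b : ideal b -> tens_ideal (tens a b).
Proof.
move=> hb; exists [:: (a, b)]; last by rewrite big_seq1.
by move=> p; rewrite inE => /eqP ->; exact: hb.
Qed.

Lemma tens_ideal_prim_mul i z : tens_ideal z -> tens_ideal (prim_mul (sroot i) z).
Proof.
case=> l hl ->; rewrite prim_mul_sum big_seq; elim/big_ind: _ => [|x y|p hp].
- exact: tens_ideal0.
- exact: tens_idealD.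
have hi := hl p hp; rewrite prim_mul_tens.
apply: tens_idealD; apply: tens_ideal_tens; first exact: hi.
by have := ideal_mull hW (posr_root (val_posr (sroot i))) hi; rewrite xroot_val.
Qed.

(* The recursion defining x_{w/v} along a word for w, read off from
   Delta(x_i x_w') = (x_i (x) 1 + 1 (x) x_i) Delta(x_w'). *)
Fixpoint skew (e : seq 'I_n) (v : gT) : T :=
  if e is i :: e' then
    xroot 'a_i * skew e' v
    + (if (len s (s i * v)%g < len s v)%N then wact (s i) (skew e' (s i * v)%g) else 0)
  else if v == 1%g then 1 else 0.

Lemma xelt1 : xelt 1%g = 1.
Proof.
by rewrite xeltE (size0nil (len1 gen : size (red_word s 1%g) = 0%N)) /xword xmono_nil.
Qed.

Lemma skew_coproduct e : exists2 z, tens_ideal z &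
  coproduct (xword e) = \sum_(v : gT) tens (skew e v) (xelt v) + z.
Proof.
elim: e => [|i e [z hz IHe]].
  exists 0; first exact: tens_ideal0.
  rewrite addr0 xword_mono coproduct_nil (bigD1 1%g) //= eqxx xelt1.
  by rewrite big1 ?addr0 // => v /negPf ->; exact: tens0l.
(* In the Nichols algebra x_i x_v is x_(s_i v) if the length goes up and 0 otherwise. *)
have hdiff v : exists2 t, tens_ideal t &
    tens (wact (s i) (skew e v)) (xroot 'a_i * xelt v) =
    tens (if (len s v < len s (s i * v))%N then wact (s i) (skew e v) else 0) (xelt (s i * v)%g) + t.
  set W := wact _ _; case: ifP => h.
    exists (tens W (xroot 'a_i * xelt v - xelt (s i * v)%g)).
      by apply: tens_ideal_tens; exact: mul_xelt_up.
    by rewrite tensDr tensNr addrC subrK.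
  exists (tens W (xroot 'a_i * xelt v)).
    apply: tens_ideal_tens; apply: mul_xelt_down.
    by have := len_mull_cases hW i v; move/negbT: h; rewrite -leqNgt; lia.
  by rewrite tens0l add0r.
have [t ht1 ht2] : exists2 t, tens_ideal t &
    \sum_(v : gT) tens (wact (s i) (skew e v)) (xroot 'a_i * xelt v) =
    \sum_(v : gT) tens (if (len s v < len s (s i * v))%N then wact (s i) (skew e v) else 0)
      (xelt (s i * v)%g) + t.
  elim/big_ind2: _ => [|x1 x2 y1 y2 [t1 h1 ->] [t2 h2 ->]|v _].
  - by exists 0; rewrite ?addr0 //; exact: tens_ideal0.
  - by exists (t1 + t2); [exact: tens_idealD|rewrite addrACA].
  exact: hdiff.
exists (t + prim_mul (sroot i) z); first by apply: tens_idealD => //; exact: tens_ideal_prim_mul.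
have hco : coproduct (xword (i :: e)) = prim_mul (sroot i) (coproduct (xword e)).
  by rewrite !xword_mono; exact: coproduct_cons.
rewrite hco IHe prim_mulD prim_mul_sum addrA; congr (_ + _).
have hx : xpos (sroot i) = xroot 'a_i by rewrite -xroot_val.
under eq_bigr => v _ do rewrite prim_mul_tens hx rr_simple //.
have e1 : \sum_(v : gT) tens (xroot 'a_i * skew e v) (xelt v) +
    \sum_(v : gT) tens (if (len s v < len s (s i * v))%N then wact (s i) (skew e v) else 0)
      (xelt (s i * v)%g) = \sum_(v : gT) tens (skew (i :: e) v) (xelt v).
  (* Renaming s_i v as v produces the second summand of the recursion and reverses the length
     condition. *)
  rewrite [X in _ + X = _](reindex_inj (mulgI (s i))) /= -big_split /=.
  by apply: eq_bigr => v _; rewrite (mulsK s2) -tensDl.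
by rewrite -e1 -addrA; apply: etrans (big_split _ _ _ _ _) _; exact: (congr1 (+%R _) ht2).
Qed.

(** Outside the Bruhat interval a family must be exactly zero, not just zero modulo the ideal; the
    lifting property carries this through the recursion. *)
Lemma skew_bruhat e v : reduced s e -> ~~ bruhat s v (word_prod s e) -> skew e v = 0.
Proof.
elim: e v => [|i e IHe] v hred /=.
  by rewrite word_prod0; case: eqVneq => // ->; rewrite /bruhat connect0.
have hred' := reduced_behead hred; rewrite word_prod_cons => hv.
set w := word_prod s e in hv *.
have hw : (len s w < len s (s i * w))%N.
  by rewrite -word_prod_cons -(reduced_size gen hred) -(reduced_size gen hred').
have hb := bruhat_smul hW R hw.
rewrite IHe // ?mulr0 ?add0r; last by apply: contra hv => h; exact: connect_trans h hb.
case: ifP => // h; rewrite IHe // ?(linear0 (@wact R gT n s _)) //.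
apply: contra hv => hsv; have := bruhat_mull hW R i hsv.
by rewrite (mulsK s2) => -[h'|//]; exact: connect_trans h' hb.
Qed.

Lemma skew_family w : is_skew_family w [ffun v => skew (red_word s w) v].
Proof.
have [h1 h2] := red_wordP gen w; split=> [|v hv]; last first.
  by rewrite ffunE; apply: skew_bruhat => //; rewrite h1.
have [z [l hl ->] hz] := skew_coproduct (red_word s w).
exists l; first by move=> p /hl; right.
rewrite xeltE hz; under [X in _ - X]eq_bigr => v _ do rewrite ffunE.
rewrite [X in _ - X]big_mkcond /= [X in X + _ - _](eq_bigr (fun v =>
  if bruhat s v w then tens (skew (red_word s w) v) (xelt v) else 0)).
  by rewrite addrC addKr.
move=> v _; case: ifP => // /negbT hv; rewrite skew_bruhat ?h1 //; exact: tens0l.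
Qed.

(** The functional dual to x_v, applied to the second factor. It isolates the value of a family at v
    and maps the kernel I (x) T + T (x) I into I. *)
Definition slice (v : gT) (z : TT) : T :=
  linext (fun kl : word * word => lpair (simple_word (red_word s v)) (mono kl.2) *: mono kl.1) z.

Lemma sliceP v c z t : slice v (c *: z + t) = c *: slice v z + slice v t.
Proof. exact: linext_is_linear. Qed.

Lemma sliceD v z t : slice v (z + t) = slice v z + slice v t.
Proof. by have := sliceP v 1 z t; rewrite !scale1r. Qed.

Lemma slice0 v : slice v 0 = 0.
Proof. by apply: (addIr (slice v 0)); rewrite -sliceD !add0r. Qed.

Lemma slice_sum v (J : Type) (l : seq J) (Q : pred J) (F : J -> TT) :
  slice v (\sum_(j <- l | Q j) F j) = \sum_(j <- l | Q j) slice v (F j).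
Proof. exact: (big_morph (slice v) (sliceD v) (slice0 v)). Qed.

Lemma slice_tens v a b : slice v (tens a b) = lpair (simple_word (red_word s v)) b *: a.
Proof.
elim/malg_ind: a => [|k|c a a' ha ha'].
- by rewrite tens0l slice0 scaler0.
- elim/malg_ind: b => [|l|c b b' hb hb'].
  + by rewrite tens0r slice0 lpair0 scale0r.
  + by apply: etrans (congr1 (slice v) (tens_mono k l)) _; rewrite /slice linextU scale1r.
  apply: etrans (congr1 (slice v) (tensPr c b b' << k >>)) _.
  apply: etrans (sliceP _ _ _ _) _.
  apply: etrans (congr2 (fun y z => c *: y + z) hb hb') _.
  by rewrite lpairP scalerDl scalerA.
apply: etrans (congr1 (slice v) (tensPl c a a' b)) _.
apply: etrans (sliceP _ _ _ _) _.
apply: etrans (congr2 (fun y z => c *: y + z) ha ha') _.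
by rewrite scalerDr !scalerA mulrC.
Qed.

Lemma slice_family v w (f : {ffun gT -> T}) : (forall u, ~~ bruhat s u w -> f u = 0) ->
  slice v (\sum_(u | bruhat s u w) tens (f u) (xelt u)) = f v.
Proof.
move=> hf; rewrite slice_sum.
have h u : slice v (tens (f u) (xelt u)) = (u == v)%:R *: f u by rewrite slice_tens xelt_dual.
rewrite (eq_bigr _ (fun u _ => h u)); have [hv|hv] := boolP (bruhat s v w).
  rewrite (bigD1 v) //= eqxx scale1r big1 ?addr0 // => u /andP[_ /negPf ->].
  by rewrite scale0r.
rewrite hf // big1 // => u hu; have [euv|_] := eqVneq u v; last by rewrite scale0r.
by rewrite -euv hu in hv.
Qed.

Lemma skew_family_unique w f g v : is_skew_family w f -> is_skew_family w g -> eqB (f v) (g v).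
Proof.
move=> [[l1 h1 e1] hf] [[l2 h2 e2] hg].
have hslice l : (forall p, p \in l -> ideal p.1 \/ ideal p.2) ->
    ideal (slice v (\sum_(p <- l) tens p.1 p.2)).
  move=> hl; rewrite slice_sum big_seq; elim/big_ind: _ => [|x y|p /hl hp].
  - exact: ideal0.
  - exact: idealD.
  rewrite slice_tens; case: hp => hp; first exact: idealZ.
  have /(nichols_idealP hW) hp' := hp.
  have hq : lpair (simple_word (red_word s v)) p.2 = 0 by apply: hp'; exact: simple_word_roots.
  by move: (lpair _ _) hq => c ->; rewrite scale0r; exact: ideal0.
have hB (z t : TT) : slice v (z - t) = slice v z - slice v t.
  by rewrite -scaleN1r addrC sliceP scaleN1r addrC.
have key (h : {ffun gT -> T}) l : (forall u, ~~ bruhat s u w -> h u = 0) ->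
    (forall p, p \in l -> ideal p.1 \/ ideal p.2) ->
    coproduct (xelt w) - \sum_(u | bruhat s u w) tens (h u) (xelt u) = \sum_(p <- l) tens p.1 p.2 ->
    ideal (slice v (coproduct (xelt w)) - h v).
  move=> hh hl e; apply: (eq_ind _ ideal (hslice l hl)).
  apply: etrans (congr1 (slice v) (esym e)) _; apply: etrans (hB _ _) _.
  exact: (congr1 (fun y => _ - y) (slice_family v hh)).
have := idealB hW (key g l2 hg h2 e2) (key f l1 hf h1 e1).
by rewrite opprB addrC subrKA.
Qed.

Lemma xskew_eq w v : eqB (xskew R s w v) (skew (red_word s w) v).
Proof.
have hs := skew_family w.
have hx : is_skew_family w (xget ([ffun=> 0] : {ffun gT -> T}) [set f | is_skew_family w f]%classic).
  exact: (@xgetI _ _ [set f | is_skew_family w f]%classic _ hs).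
by have := skew_family_unique v hx hs; rewrite ffunE.
Qed.

End SkewElements.

(** * Length two *)

Section LengthTwo.
Variables (R : realType) (gT : finGroupType) (n : nat) (s : 'I_n -> gT).
Hypothesis hW : simply_laced_weyl_group s.

Local Notation V := 'rV[R]_n.
Local Notation B := (@bform R gT n s).
Local Notation act := (@geom_act R gT n s).
Local Notation refl := (@refl R gT n s).
Local Notation isroot := (@is_root R gT n s).
Local Notation posr := (@is_posroot R gT n s).
Local Notation rr := (@root_refl R gT n s).
Local Notation xroot := (@xroot R gT n s).
Local Notation xmono := (@xmono R gT n s).
Local Notation eqB := (@nichols_eq R gT n s).
Local Notation "''a_' i" := (@simple_root R n i) (at level 8, i at level 2, format "''a_' i").
Local Notation skew := (@skew R gT n s).

Let gen := coxeter_gen hW.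
Let s2 := coxeter_invol hW.

Lemma skew_top e : reduced s e -> skew e (word_prod s e) = 1.
Proof.
elim: e => [|i e IHe] hred /=; first by rewrite word_prod0 eqxx.
have hred' := reduced_behead hred.
rewrite word_prod_cons (mulsK s2) IHe //.
have hlt : (len s (word_prod s e) < len s (s i * word_prod s e))%N.
  by rewrite -word_prod_cons -(reduced_size gen hred) -(reduced_size gen hred').
rewrite hlt skew_bruhat // ?mulr0 ?add0r; last first.
  apply/negP => /(bruhat_len) [h|]; last by rewrite ltnNge ltnW.
  by move: hlt; rewrite h ltnn.
by have := wact_xmono hW (s i) (r := [::] : seq V) isT; rewrite !xmono_nil.
Qed.

Lemma skew_same_len e v : reduced s e -> len s v = len s (word_prod s e) ->
  v <> word_prod s e -> skew e v = 0.
Proof.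
move=> hred hl hne; apply: skew_bruhat => //; apply/negP => /bruhat_len[//|].
by rewrite hl ltnn.
Qed.

Lemma bruhat_rr c (v w : gT) : isroot c -> w = (rr c * v)%g -> (len s v < len s w)%N -> bruhat s v w.
Proof.
move=> hc hw hl; apply: connect1; apply/(bruhat_stepP hW R).
have [h|h] := root_cases hW hc; first by exists c.
by exists (- c) => //; rewrite rrN.
Qed.

Lemma wact_xroot u c : isroot c -> wact u (xroot c) = xroot (act u c).
Proof.
move=> hc; have := wact_xmono hW u (r := [:: c]).
by rewrite /= !xmono_cons !xmono_nil !mulr1 hc => ->.
Qed.

Lemma conj_rr i c : isroot c -> (s i * rr c * s i = rr (refl 'a_i c))%g.
Proof. by move=> hc; rewrite -(geom_act_s hW) rr_act // (invs s2). Qed.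

(** Exactly one term of the recursion survives. If s_i raises v, then v is the product of the
    shorter word; otherwise v has the length of that product without being equal to it, and the
    first term is zero. *)
Lemma skew_cover e v : reduced s e -> bruhat s v (word_prod s e) ->
  len s (word_prod s e) = (len s v).+1 ->
  exists d, [/\ posr d, word_prod s e = (rr d * v)%g & skew e v = xroot d].
Proof.
elim: e v => [|i e IHe] v hred.
  by rewrite word_prod0 (len1 gen).
have hred' := reduced_behead hred; rewrite word_prod_cons /=.
have hlt : len s (s i * word_prod s e) = (len s (word_prod s e)).+1.
  by rewrite -word_prod_cons -(reduced_size gen hred) -(reduced_size gen hred').
have htop := skew_top hred'.
set w := word_prod s e in hlt htop IHe *; move=> hb hl.
have hlv : len s v = len s w by lia.
have hcase : v = w \/ bruhat s (s i * v) w.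
  have := bruhat_mull_top hW R i hb; rewrite (mulsK s2) => -[h|]; last by right.
  by left; case: (bruhat_len h) => //; rewrite hlv ltnn.
have [hiv|hiv] := len_mull_cases hW i v; rewrite hiv.
  have hvw : v = w.
    case: hcase => // h; case: (bruhat_len h) => [e0|]; last by lia.
    by move: hiv; rewrite e0; lia.
  exists 'a_i; rewrite rr_simple // posr_simple // hvw htop mulr1.
  by rewrite ltnNge leqnSn addr0; split.
have hne : v <> w by move=> e0; move: hiv; rewrite e0; lia.
have {hcase} hb' : bruhat s (s i * v) w by case: hcase.
have [|d [hd hw hsk]] := IHe _ hred' hb'; first by lia.
have hd' := posr_root hd.
have hdi : d <> 'a_i.
  by move=> ed; apply: hne; rewrite hw ed rr_simple // (mulsK s2).
exists (refl 'a_i d); split.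
- exact: posr_refl_simple.
- by rewrite -conj_rr // hw !mulgA.
rewrite ltnS leqnn (skew_same_len hred' hlv hne) mulr0 add0r hsk wact_xroot //.
by rewrite geom_act_s.
Qed.

(** The reflection s_i would keep both summands positive while making their sum negative. *)
Lemma simple_root_indec i d z : posr d -> posr z -> 'a_i <> d + z.
Proof.
move=> hd hz e.
have hne x y : posr x -> 'a_i = y + x -> y <> 'a_i.
  move=> hx e1 e2; case/eqP: (root_neq0 hW (posr_root hx)).
  by rewrite -[x](addKr y) -e1 e2 addNr.
have h1 := posr_refl_simple hW hd (hne z d hz e).
rewrite addrC in e; have h2 := posr_refl_simple hW hz (hne d z hd e).
have h3 : refl 'a_i 'a_i = - 'a_i by rewrite refl_self ?bform_aa.
rewrite {2}e reflD in h3.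
case/negP: (posr_opp hW (posr_simple R hW i)); rewrite -h3 posr_nnegE.
rewrite nnegD; [|by case/andP: h2|by case/andP: h1].
by rewrite h3 isrootNE ?isroot_simple.
Qed.

Lemma rr_mul_neq a c (v w : gT) : isroot a -> w = (rr a * rr c * v)%g -> len s w <> len s v -> a <> c.
Proof. by move=> ha hw hl eac; apply: hl; rewrite hw -eac rr2 // mul1g. Qed.

(* The last condition on the factorization w = r_a r_c v singles out one of the
   (at most three) candidates, which the induction has to keep track of. *)
Lemma skew_length2 e v : reduced s e -> bruhat s v (word_prod s e) ->
  len s (word_prod s e) = (len s v).+2 ->
  exists a c, [/\ posr a /\ posr c, word_prod s e = (rr a * rr c * v)%g,
    forall z, posr z -> a = c + z \/ c = a + z -> ~~ posr (act v^-1 z) &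
    eqB (skew e v) (xmono [:: a; c])].
Proof.
elim: e v => [|i e IHe] v hred.
  by rewrite word_prod0 (len1 gen).
have hred' := reduced_behead hred; rewrite word_prod_cons /=.
have hlt : len s (s i * word_prod s e) = (len s (word_prod s e)).+1.
  by rewrite -word_prod_cons -(reduced_size gen hred) -(reduced_size gen hred').
have hcover := @skew_cover e v hred'.
have hout := @skew_bruhat R gT n s hW e v hred'.
set w := word_prod s e in hlt hcover hout IHe *; move=> hb hl.
have hpi := posr_simple R hW i; have hri := isroot_simple R hW i.
have hlw : len s w = (len s v).+1 by move: hl; rewrite hlt => -[].
have hcase := bruhat_mull_top hW R i hb; rewrite (mulsK s2) in hcase.
have hwi : posr (act w^-1 'a_i) by rewrite posr_actV_simple // hlt.
have [hiv|hiv] := len_mull_cases hW i v; rewrite hiv.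
  have hvi : bruhat s v (s i * v) by apply: bruhat_smul => //; rewrite hiv.
  have hvw : bruhat s v w by case: hcase => // h; exact: connect_trans hvi h.
  have [d [hd hw hsk]] := hcover hvw hlw.
  exists 'a_i, d; split; first by split.
  - by rewrite rr_simple // hw mulgA.
  - move=> z hz [e0|e0]; first by case: (simple_root_indec hd hz e0).
    have hd' := posr_root hd; have hz' := posr_root hz.
    (* Here d = a_i + z, hence r_d(a_i) = -z. As the inverse of [w] keeps a_i positive and w = r_d
       v, the inverse of v makes z negative. *)
    have hB : B 'a_i d = 2^-1.
      have := root_norm hW hz'; have -> : z = d - 'a_i by rewrite e0 addrAC subrr add0r.
      by rewrite !bformL // !root_norm // (bformC hW d); lra.
    have h1 : refl d 'a_i = - z.
      by rewrite !reflE hB mulfV ?pnatr_eq0 // scale1r e0 opprD addNKr.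
    move: hwi; rewrite hw invMg rrV // geom_actM // geom_act_rr // h1 geom_actN //.
    by rewrite posr_oppE // isroot_act.
  rewrite hsk ltnNge leqnSn /= addr0 -[xroot d]mulr1 -xmono_nil -!xmono_cons.
  exact: nichols_eq_refl.
rewrite ltnS leqnn; set v' := (s i * v)%g in hiv hcase *.
have hv : v = (s i * v')%g by rewrite /v' (mulsK s2).
have hv'v : bruhat s v' v by rewrite {1}hv; apply: bruhat_smul => //; rewrite -hv hiv.
have hb' : bruhat s v' w by case: hcase => // h; exact: connect_trans hv'v h.
have [|a [c [[ha hc] hw hinv hsk]]] := IHe v' hred' hb'; first by rewrite hlw hiv.
have ha' := posr_root ha; have hc' := posr_root hc.
have hvact x : act v'^-1 x = act v^-1 (refl 'a_i x).
  by rewrite /v' invMg (invs s2) geom_actM // geom_act_s.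
have hvi : posr (act v^-1 'a_i) = false.
  by rewrite posr_actV_simple // -/v' hiv ltnNge leqnSn.
have hri2 : refl 'a_i 'a_i = - 'a_i by rewrite refl_self ?bform_aa.
have hwsk : eqB (wact (s i) (skew e v')) (xmono [:: refl 'a_i a; refl 'a_i c]).
  have hx : wact (s i) (xmono [:: a; c]) = xmono [:: refl 'a_i a; refl 'a_i c].
    by rewrite wact_xmono /= ?ha' ?hc' // !geom_act_s.
  exact: (eq_ind _ (eqB _) (nichols_eq_wact hW (s i) hsk) _ hx).
have hconj : (s i * w = rr (refl 'a_i a) * rr (refl 'a_i c) * v)%g.
  by rewrite -!conj_rr // hw {1}/v' !mulgA (mulKs s2).
have [hvw|hvw] := boolP (bruhat s v w); last first.
  have hlvw : (len s v < len s w)%N by rewrite hlw.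
  (* If a or c were the simple root, then s_i would cancel and make [w] a reflection times v, which
     lies above v by its length. *)
  have nac : a <> 'a_i.
    move=> ea; case/negP: hvw; apply: (@bruhat_rr (refl 'a_i c)) => //; first exact: isroot_refl.
    by rewrite -conj_rr // hw ea rr_simple // /v' !mulgA.
  have ncc : c <> 'a_i.
    move=> ec; case/negP: hvw; apply: (bruhat_rr ha') => //.
    by rewrite hw ec rr_simple // -mulgA -hv.
  exists (refl 'a_i a), (refl 'a_i c); split.
  - by split; apply: posr_refl_simple.
  - exact: hconj.
  - move=> z hz hac; have [->|nzi] := eqVneq z 'a_i; first by rewrite hvi.
    have hz2 := posr_refl_simple hW hz (elimN eqP nzi).
    have hK x : refl 'a_i (refl 'a_i x) = x by rewrite reflK ?bform_aa.
    have := hinv _ hz2; rewrite hvact hK; apply.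
    by case: hac => h; [left|right]; rewrite -[LHS]hK h reflD hK.
  by rewrite (hout hvw) mulr0 add0r.
have [d [hd hwd hskd]] := hcover hvw hlw.
have hd' := posr_root hd.
have hdi : d <> 'a_i.
  by move=> ed; move: hlw; rewrite hwd ed rr_simple // -/v' hiv => /eqP; rewrite ltn_eqF // -addn2 leq_addr.
have hrd : posr (act v^-1 (refl d 'a_i)).
  by move: hwi; rewrite hwd invMg rrV // geom_actM // geom_act_rr.
have hdpos : posr (act v^-1 d) by rewrite len_rr // -hwd hlw.
(* The inverse of v makes a_i negative but d and r_d(a_i) positive. In the orthogonal case r_d(a_i)
   = a_i, and in the acute case a_i = r_d(a_i) + d; both contradict these signs. *)
have hB : B d 'a_i = - 2^-1.
  have hnd : d <> - 'a_i by move=> e0; have := posr_opp hW hpi; rewrite -e0 hd.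
  have [h|h|//] := bform_root_cases hW hd' hri hdi hnd.
    by move: hrd; rewrite !reflE bformC // h mulr0 scale0r subr0 hvi.
  case/negP: (negbT hvi); move: hrd; rewrite !reflE bformC // h mulfV ?pnatr_eq0 // scale1r.
  rewrite geom_actB // => hp; rewrite posr_nnegE isroot_act //=.
  rewrite -[act _ 'a_i](subrK (act v^-1 d)); apply: nnegD; first by case/andP: hp.
  by case/andP: hdpos.
have hB' : B 'a_i d = - 2^-1 by rewrite bformC.
have hrid : refl 'a_i d = d + 'a_i by rewrite refl_obtuse.
have hrdi : refl d 'a_i = d + 'a_i by rewrite refl_obtuse // addrC.
have hk := posr_add_obtuse hW hpi hd hB.
have hrot : (rr a * rr c = rr d * rr 'a_i)%g.
  by apply: (mulIg v'); rewrite -hw rr_simple // hwd -mulgA -hv.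
(* The inverse of v' keeps both a_i and d positive, d being sent where the inverse of v sends d +
   a_i. The sign condition at v' thus excludes the two factorizations whose roots differ by d or by
   a_i. *)
case: (rotation_factorizations hW ha hc hd hpi hB hrot) => -[ea ec].
(* The new pair comes from s_i r_d = r_d r_(d + a_i). Its roots differ by a_i, which the inverse of
   v makes negative, so the sign condition persists. *)
- exists d, (d + 'a_i); split.
  + by split.
  + rewrite -hrdi -geom_act_rr // rr_act // rrV // rr_simple // hwd !mulgA.
    by rewrite rr2 // mul1g.
  + move=> z hz [h|h].
      have : z = - 'a_i by apply: (addrI (d + 'a_i)); rewrite -h addrK.
      by move=> ez; have := posr_opp hW hpi; rewrite -ez hz.
    by have -> : z = 'a_i; [apply: (addrI d)|rewrite hvi].
  rewrite hskd; move: hwsk; rewrite ea ec hrid hri2 => hwsk.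
  apply: (nichols_eq_trans hW (nichols_eqD hW (nichols_eq_refl hW _) hwsk)).
  have e1 : xmono [:: d + 'a_i; - 'a_i] = - xmono [:: d + 'a_i; 'a_i].
    exact: (xmono_sign hW [:: d + 'a_i] 'a_i [::]).
  have e2 : xroot 'a_i * xroot d = xmono [:: 'a_i; d].
    by rewrite !xmono_cons xmono_nil mulr1.
  apply: (eq_ind_r (fun t => eqB t _) _ (congr2 +%R e2 e1)).
  apply/(nichols_idealP hW) => g hg; have hk' := posr_root hk.
  rewrite !(lpairD, lpairN) !lpair_xmono //= ?hri ?hd' ?hk' //.
  by rewrite (pairing_triangle hW g hri hd' hB); ring.
- have := hinv d hd; rewrite hvact hrid -hrdi hrd => /(_ _)/negP; case=> //.
  by right; rewrite ec ea addrC.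
- have := hinv 'a_i hpi; rewrite hvact hri2 geom_actN // posr_oppE ?isroot_act // hvi.
  by move=> /(_ _)/negP; case=> //; left; rewrite ea ec.
Qed.

End LengthTwo.

(** * From quadratic monomials to sets of positive roots *)

Section Products.
Variables (R : realType) (gT : finGroupType) (n : nat) (s : 'I_n -> gT).
Hypothesis hW : simply_laced_weyl_group s.

Local Notation P := (posroot R s).
Local Notation isroot := (@is_root R gT n s).
Local Notation pairing := (@pairing R gT n s).
Local Notation eqB := (@nichols_eq R gT n s).

Lemma xpos2E (a c : P) : xpos a * xpos c = xmono s [:: val a; val c].
Proof. by rewrite !xmono_cons xmono_nil mulr1 !xroot_val. Qed.

Lemma eq_xpos2_pairing (a c b d : P) : eqB (xpos a * xpos c) (xpos b * xpos d) ->
  forall g, all isroot g -> pairing g [:: val a; val c] = pairing g [:: val b; val d].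
Proof.
move=> h g hg; have hr (p : P) : isroot (val p) := posr_root (val_posr p).
have e (p q : P) : lpair g (xpos p * xpos q) = pairing g [:: val p; val q].
  apply: etrans (congr1 (lpair g) (xpos2E p q)) _.
  by rewrite lpair_xmono //= !hr.
by rewrite -!e; exact: lpair_eq.
Qed.

(** Squares of root vectors vanish, whereas a product of two distinct positive root vectors pairs
    with itself to 1. *)
Lemma xpos2_neq (a c b d : P) : b <> d -> eqB (xpos a * xpos c) (xpos b * xpos d) -> a <> c.
Proof.
move=> hbd /eq_xpos2_pairing h eac; have hr (p : P) : isroot (val p) := posr_root (val_posr p).
have hg : all isroot [:: val b; val d] by rewrite /= !hr.
have := h _ hg; rewrite eac pairing_square // pairing2.
rewrite (rcoef_posr hW (val_posr b) (val_posr b)) (rcoef_posr hW (val_posr d) (val_posr d)).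
rewrite (rcoef_posr hW (val_posr d) (val_posr b)) !eqxx.
have -> : (val b == val d) = false by apply/eqP => /val_inj.
by rewrite mulr0 addr0 mulr1 => /eqP; rewrite eq_sym oner_eq0.
Qed.

Lemma xpos2_set (a c b d : P) : a <> c -> b <> d -> eqB (xpos a * xpos c) (xpos b * xpos d) ->
  [set a; c]%classic = [set b; d]%classic.
Proof.
move=> hac hbd /eq_xpos2_pairing h.
have hne (p q : P) : p <> q -> val p <> val q by move=> hpq /val_inj.
have [[e1 e2]|[e1 e2]] := pairing_distinct hW (val_posr a) (val_posr c) (val_posr b) (val_posr d)
  (hne _ _ hac) (hne _ _ hbd) h.
  by rewrite (val_inj e1) (val_inj e2).
by rewrite (val_inj e1) (val_inj e2) setUC.
Qed.

Lemma rho_xpos2 (a c : P) : rho (xpos a * xpos c) = xpos c * xpos a.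
Proof.
have h (p q : P) : xpos p * xpos q = mono ([:: p; q] : fword P).
  by rewrite /xpos /mono malg_mulU.
by apply: etrans (congr1 (@rho R gT n s) (h a c)) _; rewrite h /rho linextU scale1r.
Qed.

Lemma xskew_length2 (v w : gT) : bruhat s v w -> len s w = (len s v).+2 ->
  exists a c : P, a <> c /\ eqB (xskew R s w v) (xpos a * xpos c).
Proof.
move=> hvw hl; have [h1 h2] := red_wordP (coxeter_gen hW) w.
have [||a [c [[ha hc] hw _ hsk]]] := @skew_length2 R gT n s hW (red_word s w) v h2.
- by rewrite h1.
- by rewrite h1.
rewrite h1 in hw; exists (exist _ a ha), (exist _ c hc); split.
  case=> eac; have := rr_mul_neq hW (posr_root ha) hw; apply=> //.
  by rewrite hl => /eqP; rewrite gtn_eqF // leqnSn.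
have h3 := nichols_eq_trans hW (xskew_eq R hW w v) hsk.
exact: (eq_ind _ (eqB _) h3 _ (esym (xpos2E (exist _ a ha) (exist _ c hc)))).
Qed.

End Products.

Theorem theorem7p5 (R : realType) (gT : finGroupType) (n : nat)
    (s : 'I_n -> gT) (hW : simply_laced_weyl_group s)
    (v w : gT) (hvw : bruhat s v w) (hlen : (len s w - len s v = 2)%N) :
  (exists alpha gamma alpha' gamma' : posroot R s,
     nichols_eq (xskew R s w v) (xpos alpha * xpos gamma) /\
     nichols_eq (xskew_circ R s w v) (xpos alpha' * xpos gamma')) /\
  (forall alpha gamma alpha' gamma' : posroot R s,
     nichols_eq (xskew R s w v) (xpos alpha * xpos gamma) ->
     nichols_eq (xskew_circ R s w v) (xpos alpha' * xpos gamma') ->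
     alpha <> gamma /\ alpha' <> gamma') /\
  (forall alpha1 gamma1 alpha1' gamma1' alpha2 gamma2 alpha2' gamma2' :
     posroot R s,
     nichols_eq (xskew R s w v) (xpos alpha1 * xpos gamma1) ->
     nichols_eq (xskew_circ R s w v) (xpos alpha1' * xpos gamma1') ->
     nichols_eq (xskew R s w v) (xpos alpha2 * xpos gamma2) ->
     nichols_eq (xskew_circ R s w v) (xpos alpha2' * xpos gamma2') ->
     [set alpha1; gamma1]%classic = [set alpha2; gamma2]%classic /\
     [set alpha1'; gamma1']%classic = [set alpha2'; gamma2']%classic).
Proof.
(* A truncated difference with the nonzero value 2 is a true difference. *)
have hl : len s w = (len s v).+2 by lia.
have hlV : len s w^-1 = (len s v^-1).+2.
  by rewrite !(lenV (coxeter_gen hW) (coxeter_invol hW)).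
have [a [c [hac h]]] := xskew_length2 R hW hvw hl.
have [a' [c' [hac' h']]] := xskew_length2 R hW (bruhatV hW hvw) hlV.
have hca' : c' <> a' by move=> e; apply: hac'.
have hc : nichols_eq (xskew_circ R s w v) (xpos c' * xpos a').
  exact: (eq_ind _ (nichols_eq _) (nichols_eq_rho hW h') _ (rho_xpos2 a' c')).
(* Any factorization is compared with the constructed one, whose roots are known to be distinct;
   this gives distinctness and uniqueness together. *)
have key (x y p q : posroot R s) t : p <> q -> nichols_eq t (xpos p * xpos q) ->
    nichols_eq t (xpos x * xpos y) -> x <> y /\ [set x; y]%classic = [set p; q]%classic.
  move=> hpq h1 h2; have h3 := nichols_eq_trans hW (nichols_eq_sym hW h2) h1.
  have hxy := xpos2_neq hW hpq h3; split=> //; exact: xpos2_set h3.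
split; first by exists a, c, c', a'.
split=> [x y x' y' h1 h2|x y x' y' p q p' q' h1 h2 h3 h4].
  by have [? _] := key x y _ _ _ hac h h1; have [? _] := key x' y' _ _ _ hca' hc h2.
have [_ ->] := key x y _ _ _ hac h h1; have [_ ->] := key x' y' _ _ _ hca' hc h2.
by have [_ ->] := key p q _ _ _ hac h h3; have [_ ->] := key p' q' _ _ _ hca' hc h4.
Qed.
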